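(* Let $\Theta=\sum_{k=1}^{+\infty}\Theta_k\in \mathrm{Hom}(\bar{\mathsf S}(\mathfrak h),\mathfrak g)$ be a homotopy Rota-Baxter operator on an open-closed homotopy Lie algebra $(\mathfrak g,\mathfrak h,\{l_k\}_{k\ge1},\{\mathfrak R_{p,q}\}_{p+q\ge1})$ given by an $L_\infty$-action $\rho=\{\rho_k\}_{k=1}^{+\infty}$ of an $L_\infty$-algebra $(\mathfrak g,\{l_k\}_{k=1}^{+\infty})$ on an $L_\infty$-algebra $(\mathfrak h,\{\mu_k\}_{k=1}^{+\infty})$. Then $(\mathfrak h,\{\mathfrak M_{p,q}\}_{p\ge0,q\ge1})$ is a post-Lie$_\infty$ algebra, where $\mathfrak M_{0,q}=\mu_q$ and, for $p\ge1$, $q\ge 1$, $$\begin{aligned} &\mathfrak M_{p,q}(u_1\cdots u_p\otimes u_{p+1} \cdots u_{p+q})\\ &=\sum_{k=1}^{p}\ \sum_{\substack{i_1+\cdots+i_{k}=p\\ i_1,\ldots,i_{k}\ge 1}}\ \sum_{\sigma\in\mathbb S_{(i_1,\ldots,i_{k})}}\frac{\varepsilon(\sigma)}{k!}\,\mathfrak R_{k,q}\Big(\Theta_{i_1}(u_{\sigma(1)} \cdots u_{\sigma(i_1)}) \cdots \Theta_{i_{k}}(u_{\sigma(i_1+\cdots+i_{k-1}+1)} \cdots u_{\sigma(p)})\otimes u_{p+1} \cdots u_{p+q}\Big). \end{aligned}$$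
   Context: The ground field has characteristic zero; graded means $\mathbb Z$-graded; in exponents of $-1$ a homogeneous element stands for its degree. $\mathsf S(V)=\bigoplus_{n\ge0}\mathsf S^n(V)$ is the graded symmetric algebra (also regarded as the cofree conilpotent cocommutative coalgebra with the shuffle coproduct), $\bar{\mathsf S}(V)=\bigoplus_{n\ge1}\mathsf S^n(V)$; products are written by juxtaposition; $\mathbb S_{(i_1,\dots,i_k)}$ is the set of $(i_1,\dots,i_k)$-shuffles; $\varepsilon(\sigma)$ is the Koszul sign: $v_1\cdots v_n=\varepsilon(\sigma)v_{\sigma(1)}\cdots v_{\sigma(n)}$ in $\mathsf S(V)$. An $L_\infty$-algebra $(\mathfrak g,\{l_k\}_{k\ge1})$ is a graded vector space with graded symmetric maps $l_k:\mathsf S^k(\mathfrak g)\to\mathfrak g$ of degree $1$ such that for all $n\ge1$: $\sum_{i=1}^{n}\sum_{\sigma\in \mathbb S_{(i,n-i)}}\varepsilon(\sigma)l_{n-i+1}(l_i(x_{\sigma(1)},\ldots,x_{\sigma(i)}),x_{\sigma(i+1)},\ldots,x_{\sigma(n)})=0$. An open-closed homotopy Lie algebra $(\mathfrak g,\mathfrak h,\{l_k\}_{k\ge1},\{\mathfrak R_{p,q}\}_{p+q\ge1})$ is an $L_\infty$-algebra $(\mathfrak g,\{l_k\})$, a graded vector space $\mathfrak h$ and degree $1$ linear maps $\mathfrak R_{p,q}:\mathsf S^p(\mathfrak g)\otimes \mathsf S^q(\mathfrak h)\to\mathfrak h$ ($p,q\ge0$, $p+q\ge1$; put $\mathfrak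 R_{0,0}=0$) such that for all $n+m\ge1$, $x_i\in\mathfrak g$, $u_j\in\mathfrak h$ $$\begin{aligned}&\sum_{i=1}^{n}\sum_{\sigma\in \mathbb S_{(i,n-i)}}\varepsilon(\sigma)\mathfrak R_{n-i+1,m}\Big(l_i(x_{\sigma(1)},\ldots,x_{\sigma(i)})x_{\sigma(i+1)}\cdots x_{\sigma(n)}\otimes u_1 \cdots u_m\Big)\\ &+\sum_{i=0}^{n}\sum_{k=0}^{m}\sum_{\sigma\in\mathbb S_{(i,n-i)}}\sum_{\tau\in\mathbb S_{(k,m-k)}}\varepsilon(\sigma)\varepsilon(\tau)(-1)^{x_{\sigma(1)}+\cdots+x_{\sigma(i)}}\\ &\mathfrak R_{i,m-k+1}\Big(x_{\sigma(1)} \cdots x_{\sigma(i)}\otimes \mathfrak R_{n-i,k}\big(x_{\sigma(i+1)} \cdots x_{\sigma(n)}\otimes u_{\tau(1)} \cdots u_{\tau(k)}\big) u_{\tau(k+1)} \cdots u_{\tau(m)}\Big)=0.\end{aligned}$$ An $L_\infty$-action of $(\mathfrak g,\{l_k\})$ on $(\mathfrak h,\{\mu_k\})$ is the same as an open-closed homotopy Lie algebra with $\mathfrak R_{0,q}=\mu_q$ for $q\ge1$ and $\mathfrak R_{p,0}=0$ for all $p\ge1$. In terms of the equivalent description by an $L_\infty$-homomorphism $\rho=\{\rho_k\}$ from $\mathfrak g$ to $s^{-1}\mathrm{coDer}(\bar{\mathsf S}(\mathfrak h))$ ($s^{-1}$ is desuspension), one has $\mathfrak R_{p,q}(x_1\cdots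 x_p\otimes u_1\cdots u_q)=\mathrm{pr}_{\mathfrak h}\big((s\rho_p)(x_1,\dots,x_p)(u_1\cdots u_q)\big)$ for $p,q\ge1$. Given an open-closed homotopy Lie algebra, $\mathfrak g\oplus\mathfrak h$ is an $L_\infty$-algebra with $\mathcal R_k\big((x_1,u_1),\ldots,(x_k,u_k)\big)=\big(l_k(x_1,\ldots,x_k),\sum_{i=0}^{k}\sum_{\sigma\in \mathbb S_{(i,k-i)}}\varepsilon(\sigma)\mathfrak R_{i,k-i}(x_{\sigma(1)} \cdots x_{\sigma(i)}\otimes u_{\sigma(i+1)} \cdots u_{\sigma(k)})\big)$. For $f\in\mathrm{Hom}(\bar{\mathsf S}(V),V)$ let $\hat f$ be the corresponding coderivation of $\bar{\mathsf S}(V)$. Let $\Phi=\hat{\mathcal R}$ with $\mathcal R=\sum_k\mathcal R_k$, $[\cdot,\cdot]_C$ the graded commutator of coderivations of $\bar{\mathsf S}(\mathfrak g\oplus\mathfrak h)$, and $P$ the projection of $\mathrm{coDer}(\bar{\mathsf S}(\mathfrak g\oplus\mathfrak h))\cong\mathrm{Hom}(\bar{\mathsf S}(\mathfrak g\oplus\mathfrak h),\mathfrak g\oplus\mathfrak h)$ onto the subspace $\mathcal H$ of coderivations given by $\mathrm{Hom}(\bar{\mathsf S}(\mathfrak h),\mathfrak g)$ (restrict to $\bar{\mathsf S}(\mathfrak h)$ and project to $\mathfrak g$). A homotopy Rota-Baxter operator is a degree $0$ element $\Theta=\sum_{k\ge1}\Theta_k\in\mathrm{Hom}(\bar{\mathsf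 S}(\mathfrak h),\mathfrak g)$, $\Theta_k:\mathsf S^k(\mathfrak h)\to\mathfrak g$, such that $P\big(e^{[\cdot,\hat\Theta]_C}\Phi\big)=0$, where $e^{[\cdot,\hat\Theta]_C}\Phi=\sum_{k\ge0}\frac1{k!}[\dots[[\Phi,\hat\Theta]_C,\hat\Theta]_C,\dots,\hat\Theta]_C$ ($k$ brackets). A post-Lie$_\infty$ algebra is a graded vector space $\mathfrak g$ with linear maps $\mathfrak M_{p,q}:\mathsf S^p(\mathfrak g)\otimes \mathsf S^q(\mathfrak g)\to\mathfrak g$ of degree $1$, $p\ge0,q\ge1$, such that for all $n\ge 0,m\ge1$ and homogeneous $x_1,\dots,x_{n+m}$ $$\begin{aligned}&\sum_{\substack{0\le j\le n-1,\,1\le i\le n\\ i+j\le n}}\ \sum_{\sigma\in \mathbb S_{(j,i,n-j-i)}}\varepsilon(\sigma)\mathfrak M_{n-j-i+1,m}\Big(\mathfrak M_{j,i}(x_{\sigma(1)}\cdots x_{\sigma(j)}\otimes x_{\sigma(j+1)}\cdots x_{\sigma(j+i)})x_{\sigma(j+i+1)}\cdots x_{\sigma(n)}\otimes x_{n+1}\cdots x_{n+m}\Big)\\ &+\sum_{0\le j\le n}\sum_{\sigma\in\mathbb S_{(n-j,j)}}\sum_{1\le i\le m}\sum_{\tau\in\mathbb S_{(i,m-i)}}\varepsilon(\sigma)\varepsilon(\tau)(-1)^{x_{\sigma(1)}+\cdots+x_{\sigma(n-j)}}\\ &\mathfrak M_{n-j,m-i+1}\Big(x_{\sigma(1)} \cdots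 x_{\sigma(n-j)}\otimes \mathfrak M_{j,i}\big(x_{\sigma(n-j+1)} \cdots x_{\sigma(n)}\otimes x_{n+\tau(1)} \cdots x_{n+\tau(i)}\big) x_{n+\tau(i+1)} \cdots x_{n+\tau(m)}\Big)=0.\end{aligned}$$ *)

(* Defs.v *)
From HB Require Import structures.
From mathcomp Require Import all_boot all_fingroup all_algebra.
From mathcomp Require Import boolp finmap monalg zify.

Set Implicit Arguments.
Unset Strict Implicit.
Unset Printing Implicit Defensive.

Import GRing.Theory.
Local Open Scope ring_scope.

Inductive span (K : fieldType) (V : lmodType K) (X : V -> Prop) : V -> Prop :=
| span_zero : span X 0
| span_step (a : K) (x y : V) : X x -> span X y -> span X (a *: x + y).

Section Presented.
Variables (K : fieldType) (T : choiceType) (rel : {malg K[T]} -> Prop).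

Definition relator : {pred {malg K[T]}} := fun x => `[< span rel x >].

Fact relator_zmod_closed : zmod_closed relator.
Proof.
have sD x y : span rel x -> span rel y -> span rel (x + y).
  move=> sx sy; elim: sx => [|a u v Xu _ IH]; first by rewrite add0r.
  by rewrite -addrA; exact: span_step.
have sN x : span rel x -> span rel (- x).
  elim=> [|a u v Xu _ IH]; first by rewrite oppr0; exact: span_zero.
  by rewrite opprD -scaleNr; exact: span_step.
split; first by apply/asboolP; exact: span_zero.
by move=> x y /asboolP sx /asboolP sy; apply/asboolP/sD => //; exact: sN.
Qed.
HB.instance Definition _ :=
  GRing.isZmodClosed.Build {malg K[T]} relator relator_zmod_closed.

Lemma relatorZ a x : x \in relator -> a *: x \in relator.
Proof.
move=> /asboolP sx; apply/asboolP.
elim: sx => [|b u v Xu _ IH]; first by rewrite scaler0; exact: span_zero.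
by rewrite scalerDr scalerA; exact: span_step.
Qed.

Definition presented : Type := Quotient.quot relator.
HB.instance Definition _ := GRing.Zmodule.on presented.

Definition pres_class (x : {malg K[T]}) : presented := \pi_(Quotient.quot relator)%qT x.
Definition pres_repr (x : presented) : {malg K[T]} := generic_quotient.repr (x : Quotient.quot relator).

Lemma pres_reprK : cancel pres_repr pres_class.
Proof. exact: reprK. Qed.

Lemma pres_class_eq x y : (pres_class x = pres_class y) <-> (x - y \in relator).
Proof.
rewrite (@Quotient.idealrBE _ relator); split=> [e|/eqP e]; [apply/eqP|]; exact: e.
Qed.

Lemma pres_classD : {morph pres_class : x y / x + y}.
Proof. exact: (raddfD (\pi_(Quotient.quot relator)%qT)). Qed.

Definition pres_scale (a : K) (x : presented) : presented :=
  pres_class (a *: pres_repr x).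

Lemma pres_classZ a x : pres_class (a *: x) = pres_scale a (pres_class x).
Proof.
apply/pres_class_eq; rewrite -scalerBr; apply: relatorZ.
by apply/pres_class_eq; rewrite pres_reprK.
Qed.

Fact pres_scaleA a b x : pres_scale a (pres_scale b x) = pres_scale (a * b) x.
Proof. by rewrite -[x]pres_reprK -!pres_classZ scalerA. Qed.
Fact pres_scale1 : left_id 1 pres_scale.
Proof. by move=> x; rewrite -[x]pres_reprK -pres_classZ scale1r. Qed.
Fact pres_scaleDr : right_distributive pres_scale +%R.
Proof.
move=> a x y; rewrite -[x]pres_reprK -[y]pres_reprK -pres_classD -!pres_classZ.
by rewrite scalerDr pres_classD.
Qed.
Fact pres_scaleDl x : {morph pres_scale^~ x : a b / a + b}.
Proof.
by move=> a b; rewrite -[x]pres_reprK -!pres_classZ scalerDl pres_classD.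
Qed.
HB.instance Definition _ := GRing.Zmodule_isLmodule.Build K presented
  pres_scaleA pres_scale1 pres_scaleDr pres_scaleDl.

Lemma pres_class_linear : linear pres_class.
Proof. by move=> a x y; rewrite pres_classD pres_classZ. Qed.

Lemma pres_class_rel x y : rel (x - y) -> pres_class x = pres_class y.
Proof.
move=> r; apply/pres_class_eq/asboolP.
by rewrite -[x - y]addr0 -[x - y]scale1r; apply: span_step => //; exact: span_zero.
Qed.

Definition pres_gen (t : T) : presented := pres_class << t >>.

Section Lift.
Variables (W : lmodType K) (phi : T -> W).

Definition linext (x : {malg K[T]}) : W := \sum_(t <- msupp x) x@_t *: phi t.

(* The linear map induced by phi; meaningful when phi respects the
   relations, in which case the choice of representative is irrelevant
   (pres_lift_linear, pres_lift_gen). *)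
Definition pres_lift (x : presented) : W := linext (pres_repr x).

Lemma linextE (d : {fset T}) x : (msupp x `<=` d)%fset ->
  linext x = \sum_(t <- d) x@_t *: phi t.
Proof.
move=> sub; rewrite /linext (big_fset_incl _ sub) // => t _ nt.
by rewrite mcoeff_outdom // scale0r.
Qed.

Lemma linext_linear : linear linext.
Proof.
move=> a x y; pose d := (msupp x `|` msupp y `|` msupp (a *: x + y))%fset.
have [dx dy dz] : [/\ msupp x `<=` d, msupp y `<=` d & msupp (a *: x + y) `<=` d]%fset.
  rewrite /d fsubsetUr; split=> //; first by rewrite -fsetUA fsubsetUl.
  by rewrite fsetUAC fsubsetUr.
rewrite (linextE dx) (linextE dy) (linextE dz).
rewrite scaler_sumr -big_split /=; apply: eq_bigr => t _.
by rewrite mcoeffD mcoeffZ scalerDl scalerA.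
Qed.

Lemma linext_gen t : linext << t >> = phi t.
Proof.
by rewrite (@linextE [fset t]%fset) ?msuppU_le // big_seq_fset1 mcoeffUU scale1r.
Qed.

Hypothesis phi_rel : forall x, rel x -> linext x = 0.

Lemma pres_lift_class x : pres_lift (pres_class x) = linext x.
Proof.
have /pres_class_eq /asboolP := pres_reprK (pres_class x).
rewrite /pres_lift; move: (pres_repr _) => y sp.
have lB a u v : linext (a *: u + v) = a *: linext u + linext v.
  exact: linext_linear.
have l0 : linext 0 = 0.
  by have := lB (-1) 0 0; rewrite scaler0 addr0 scaleN1r addNr.
have z u : span rel u -> linext u = 0.
  elim=> [//|a v w rv _ IH]; by rewrite lB phi_rel // IH scaler0 addr0.
have := lB 1 (y - x) x; rewrite scale1r subrK => ->.
by rewrite scale1r (z _ sp) add0r.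
Qed.

Lemma pres_lift_linear : linear pres_lift.
Proof.
move=> a x y; rewrite -[x]pres_reprK -[y]pres_reprK.
by rewrite -[a *: pres_class _]pres_classZ -pres_classD !pres_lift_class linext_linear.
Qed.

Lemma pres_lift_gen t : pres_lift (pres_gen t) = phi t.
Proof. by rewrite pres_lift_class linext_gen. Qed.

End Lift.
End Presented.

Section Tensor.
Variables (K : fieldType) (A B : lmodType K).

Inductive tensor_rel : {malg K[(A * B)%type]} -> Prop :=
| tensor_linl (a : K) (x x' : A) (y : B) :
    tensor_rel (<< (a *: x + x', y) >> - (a *: << (x, y) >> + << (x', y) >>))
| tensor_linr (a : K) (x : A) (y y' : B) :
    tensor_rel (<< (x, a *: y + y') >> - (a *: << (x, y) >> + << (x, y') >>)).

Definition tensor : Type := presented tensor_rel.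
HB.instance Definition _ := GRing.Lmodule.on tensor.

Definition tens (x : A) (y : B) : tensor := pres_gen tensor_rel (x, y).

Lemma tens_linl a x x' y : tens (a *: x + x') y = a *: tens x y + tens x' y.
Proof.
rewrite /tens /pres_gen -pres_class_linear; apply: pres_class_rel; exact: tensor_linl.
Qed.

Lemma tens_linr a x y y' : tens x (a *: y + y') = a *: tens x y + tens x y'.
Proof.
rewrite /tens /pres_gen -pres_class_linear; apply: pres_class_rel; exact: tensor_linr.
Qed.
End Tensor.

(* f (x) g, without any sign; meaningful for linear f and g. *)
Definition tens_map (K : fieldType) (A B A' B' : lmodType K)
    (f : A -> A') (g : B -> B') : tensor A B -> tensor A' B' :=
  pres_lift (fun p : (A * B)%type => tens (f p.1) (g p.2)).

Section TensMap.
Variables (K : fieldType) (A B A' B' : lmodType K).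
Variables (f : A -> A') (g : B -> B').
Hypotheses (lf : linear f) (lg : linear g).

Let tens_map_rel x : @tensor_rel K A B x ->
  linext (fun p : (A * B)%type => tens (f p.1) (g p.2)) x = 0.
Proof.
pose phi := (fun p : (A * B)%type => tens (f p.1) (g p.2)).
pose L := linext phi; have lL : linear L := @linext_linear _ _ _ phi.
have LB a u v w : L (u - (a *: v + w)) = L u - (a *: L v + L w).
  have e : u - (a *: v + w) = (-1) *: (a *: v + w) + u by rewrite scaleN1r addrC.
  by rewrite e !lL scaleN1r addrC.
by case=> [a u u' v|a u v v']; rewrite -/L LB /L !linext_gen /phi /=
  ?lf ?lg ?tens_linl ?tens_linr subrr.
Qed.

Lemma tens_map_linear : linear (tens_map f g).
Proof. exact: pres_lift_linear tens_map_rel. Qed.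

Lemma tens_mapE x y : tens_map f g (tens x y) = tens (f x) (g y).
Proof. exact: pres_lift_gen tens_map_rel _. Qed.
End TensMap.

(* A Z-grading is given by the projections [hcomp d] onto the homogeneous
   components, so that no dependent type is needed for sums of elements of
   different degrees. *)
Structure gvect (K : fieldType) := GVect {
  gsort :> lmodType K;
  hcomp : int -> gsort -> gsort;
  hcomp_linear : forall d, linear (hcomp d);
  hcomp_proj : forall d e v, hcomp d (hcomp e v) = if d == e then hcomp e v else 0;
  hcomp_sum : forall v, exists2 r : seq int, uniq r & v = \sum_(d <- r) hcomp d v }.

Section Graded.
Variable K : fieldType.

Definition homog (V : gvect K) (d : int) (v : V) : bool := hcomp d v == v.

(* Homogeneous elements, each with a chosen degree (0 has every degree). *)
Definition helt (V : gvect K) : Type := {p : int * V | homog p.1 p.2}.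
HB.instance Definition _ (V : gvect K) := Choice.on (helt V).
Definition hdeg (V : gvect K) (x : helt V) : int := (val x).1.
Definition hval (V : gvect K) (x : helt V) : V := (val x).2.

Definition word (V : gvect K) : Type := seq (helt V).
HB.instance Definition _ (V : gvect K) := Choice.on (word V).
Definition wdeg (V : gvect K) (w : word V) : int := \sum_(x <- w) hdeg x.
Definition vals (V : gvect K) (w : word V) : seq V := map (@hval V) w.

Section Dsum.
Variables V W : gvect K.

Definition dsum_comp (d : int) (p : V * W) : (V * W)%type := (hcomp d p.1, hcomp d p.2).

Fact dsum_comp_linear d : linear (dsum_comp d).
Proof. by move=> a x y; rewrite /dsum_comp /= !hcomp_linear. Qed.

Fact dsum_comp_proj d e v :
  dsum_comp d (dsum_comp e v) = if d == e then dsum_comp e v else 0.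
Proof. by rewrite /dsum_comp /= !hcomp_proj; case: eqP. Qed.

Lemma hcomp_sub_sum (U : gvect K) (v : U) (r r' : seq int) : uniq r -> uniq r' ->
  {subset r <= r'} -> v = \sum_(d <- r) hcomp d v -> v = \sum_(d <- r') hcomp d v.
Proof.
move=> ur ur' sub e.
have z d : d \notin r -> hcomp d v = 0.
  move=> dr; rewrite e; have := hcomp_linear (g := U) d => l.
  have l0 : hcomp d (0 : U) = 0.
    by have := l (-1) 0 0; rewrite scaler0 addr0 scaleN1r addNr.
  have lD x y : hcomp d (x + y) = hcomp d x + hcomp d y :> U.
    by rewrite -[x]scale1r l !scale1r.
  rewrite (big_morph _ lD l0) big_seq big1 // => i ir.
  by rewrite hcomp_proj; case: eqP => // ei; rewrite ei ir in dr.
rewrite (bigID (mem r)) /= [X in _ + X]big1 ?addr0; last by move=> d /z.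
rewrite -big_filter [LHS]e; apply: perm_big; apply: uniq_perm => //.
  exact: filter_uniq.
by move=> d; rewrite mem_filter /=; case dr: (d \in r) => //=; rewrite sub.
Qed.

Fact dsum_comp_sum p :
  exists2 r : seq int, uniq r & p = \sum_(d <- r) dsum_comp d p.
Proof.
case: p => v w; have [r ur ev] := hcomp_sum v; have [t ut ew] := hcomp_sum w.
exists (undup (r ++ t)); first exact: undup_uniq.
have ev' : v = \sum_(d <- undup (r ++ t)) hcomp d v.
  apply: hcomp_sub_sum ev => //; first exact: undup_uniq.
  by move=> d dr; rewrite mem_undup mem_cat dr.
have ew' : w = \sum_(d <- undup (r ++ t)) hcomp d w.
  apply: hcomp_sub_sum ew => //; first exact: undup_uniq.
  by move=> d dr; rewrite mem_undup mem_cat dr orbT.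
rewrite {1}ev' {1}ew'; elim: (undup _) => [|d s IH]; first by rewrite !big_nil.
by rewrite !big_cons -IH.
Qed.

Definition dsum : gvect K :=
  @GVect K (V * W)%type dsum_comp dsum_comp_linear dsum_comp_proj dsum_comp_sum.

Fact hinr_subproof (u : helt W) : homog (hdeg u) ((0, hval u) : dsum).
Proof.
rewrite /homog /= /dsum_comp /=; have /eqP e := valP u; rewrite [hcomp _ (hval u)]e.
have := @hcomp_linear _ V (hdeg u) (-1) 0 0.
by rewrite scaler0 addr0 scaleN1r addNr => ->.
Qed.
Definition hinr (u : helt W) : helt dsum := Sub (hdeg u, (0, hval u)) (hinr_subproof u).
End Dsum.

Definition sgn (d : int) : K := (-1) ^ d.

(* x_(s 0), ..., x_(s (n-1)) *)
Definition pword (T : Type) (n : nat) (x : 'I_n -> T) (s : 'S_n) : seq T :=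
  [seq x (s i) | i <- enum 'I_n].

Definition koszul (V : gvect K) (n : nat) (x : 'I_n -> helt V) (s : 'S_n) : K :=
  \prod_(i < n) \prod_(j < n | (i < j)%N && (s j < s i)%N)
    sgn (hdeg (x (s i)) * hdeg (x (s j))).

(* s is increasing on each of the consecutive blocks of sizes c *)
Definition shuffle (c : seq nat) (n : nat) (s : 'S_n) : bool :=
  all (sorted ltn) (reshape c [seq val (s i) | i <- enum 'I_n]).

(* A family of linear maps S^k(V) -> W, k >= 1, is encoded by one function f on
   lists: the k-th map is f on lists of length k, f [:: v_1; ..; v_k] being its
   value on the product v_1 .. v_k. It must be multilinear and graded
   symmetric. Unless stated otherwise f [::] is irrelevant. *)
Definition multisym (V : gvect K) (W : lmodType K) (f : seq V -> W) : Prop :=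
  (forall (s1 s2 : seq V) (a : K) (x y : V),
     f (s1 ++ (a *: x + y) :: s2) = a *: f (s1 ++ x :: s2) + f (s1 ++ y :: s2))
  /\
  (forall (s1 s2 : seq V) (x y : helt V),
     f (s1 ++ hval x :: hval y :: s2)
     = sgn (hdeg x * hdeg y) *: f (s1 ++ hval y :: hval x :: s2)).

Definition has_degree (V W : gvect K) (e : int) (f : seq V -> W) : Prop :=
  forall w : word V, w <> [::] -> homog (wdeg w + e) (f (vals w)).

Definition L_infty (g : gvect K) (l : seq g -> g) : Prop :=
  [/\ multisym l, has_degree 1 l &
   forall (n : nat) (x : 'I_n -> helt g), (0 < n)%N ->
   \sum_(1 <= i < n.+1) \sum_(s : 'S_n | shuffle [:: i; n - i]%N s)
     koszul x s *:
       (let xs := vals (pword x s) in l (l (take i xs) :: drop i xs)) = 0].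

(* R xs us is the value of R_{p,q}, p = size xs, q = size us. *)
Definition open_closed (g h : gvect K) (l : seq g -> g)
    (R : seq g -> seq h -> h) : Prop :=
  [/\ L_infty l,
      R [::] [::] = 0,
      (forall us, multisym (fun xs => R xs us)) /\ (forall xs, multisym (R xs)),
      (forall (v : word g) (w : word h), (0 < size v + size w)%N ->
         homog (wdeg v + wdeg w + 1) (R (vals v) (vals w))) &
   forall (n m : nat) (x : 'I_n -> helt g) (u : 'I_m -> helt h), (0 < n + m)%N ->
   (\sum_(1 <= i < n.+1) \sum_(s : 'S_n | shuffle [:: i; n - i]%N s)
      koszul x s *:
        (let xs := vals (pword x s) in
         R (l (take i xs) :: drop i xs) (vals (codom u))))
   + (\sum_(0 <= i < n.+1) \sum_(0 <= k < m.+1)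
      \sum_(s : 'S_n | shuffle [:: i; n - i]%N s)
      \sum_(t : 'S_m | shuffle [:: k; m - k]%N t)
      (koszul x s * koszul u t * sgn (wdeg (take i (pword x s)))) *:
        (let xs := vals (pword x s) in let us := vals (pword u t) in
         R (take i xs) (R (drop i xs) (take k us) :: drop k us))) = 0].

(* An L_infty-action of (g, l) on (h, mu), in its open-closed description. *)
Definition L_infty_action (g h : gvect K) (l : seq g -> g) (mu : seq h -> h)
    (R : seq g -> seq h -> h) : Prop :=
  [/\ L_infty l, L_infty mu, open_closed l R,
      forall us, us <> [::] -> R [::] us = mu us &
      forall xs, xs <> [::] -> R xs [::] = 0].

(* M us vs is the value of M_{p,q}, p = size us >= 0, q = size vs >= 1. *)
Definition post_Lie_infty (g : gvect K) (M : seq g -> seq g -> g) : Prop :=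
  [/\ (forall ys, ys <> [::] -> multisym (fun xs => M xs ys))
        /\ (forall xs, multisym (M xs)),
      (forall v w : word g, w <> [::] ->
         homog (wdeg v + wdeg w + 1) (M (vals v) (vals w))) &
   forall (n m : nat) (x : 'I_n -> helt g) (y : 'I_m -> helt g), (0 < m)%N ->
   (\sum_(0 <= j < n) \sum_(1 <= i < n.+1 | (i + j <= n)%N)
      \sum_(s : 'S_n | shuffle [:: j; i; n - j - i]%N s)
      koszul x s *:
        (let xs := vals (pword x s) in
         M (M (take j xs) (take i (drop j xs)) :: drop (j + i)%N xs)
           (vals (codom y))))
   + (\sum_(0 <= j < n.+1) \sum_(s : 'S_n | shuffle [:: n - j; j]%N s)
      \sum_(1 <= i < m.+1) \sum_(t : 'S_m | shuffle [:: i; m - i]%N t)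
      (koszul x s * koszul y t * sgn (wdeg (take (n - j)%N (pword x s)))) *:
        (let xs := vals (pword x s) in let ys := vals (pword y t) in
         M (take (n - j)%N xs)
           (M (drop (n - j)%N xs) (take i ys) :: drop i ys))) = 0].

Section SymCoalgebra.
Variable V : gvect K.

(* Words of homogeneous letters modulo multilinearity and graded
   commutativity present S(V); killing the empty word leaves the positive part,
   namely the direct sum of the S^n(V) for n >= 1. *)
Inductive sym_rel : {malg K[word V]} -> Prop :=
| sym_nil : sym_rel << [::] : word V >>
| sym_lin (w1 w2 : word V) (a : K) (x y z : helt V) :
    hdeg z = hdeg x -> hdeg z = hdeg y -> hval z = a *: hval x + hval y ->
    sym_rel (<< w1 ++ z :: w2 : word V >>
             - (a *: << w1 ++ x :: w2 : word V >> + << w1 ++ y :: w2 : word V >>))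
| sym_comm (w1 w2 : word V) (x y : helt V) :
    sym_rel (<< w1 ++ x :: y :: w2 : word V >>
             - sgn (hdeg x * hdeg y) *: << w1 ++ y :: x :: w2 : word V >>).

Definition Sbar : Type := presented sym_rel.
HB.instance Definition _ := GRing.Lmodule.on Sbar.

Definition sprod (w : word V) : Sbar := pres_gen sym_rel w.

Definition Sbar_homog (d : int) : Sbar -> Prop :=
  span (fun X => exists2 w : word V, wdeg w = d & X = sprod w).

(* the projection onto S^1(V) = V *)
Definition corestr : Sbar -> V :=
  pres_lift (fun w : word V => if w is [:: x] then hval x else 0).

(* X |-> (-1)^(e |X|) X on homogeneous X *)
Definition Sbar_sign (e : int) : Sbar -> Sbar :=
  pres_lift (fun w : word V => sgn (e * wdeg w) *: sprod w).

(* the reduced shuffle coproduct *)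
Definition comul_word (n : nat) (x : 'I_n -> helt V) : tensor Sbar Sbar :=
  \sum_(1 <= i < n) \sum_(s : 'S_n | shuffle [:: i; n - i]%N s)
    koszul x s *: tens (sprod (take i (pword x s))) (sprod (drop i (pword x s))).
Definition comul : Sbar -> tensor Sbar Sbar :=
  pres_lift (fun w : word V => comul_word (tnth (in_tuple w))).

(* D has degree e and comul D = (D (x) id + id (x) D) comul, where
   (id (x) D) (X (x) Y) = (-1)^(e |X|) X (x) D Y. *)
Definition coderivation (e : int) (D : Sbar -> Sbar) : Prop :=
  [/\ linear D,
      forall w : word V, Sbar_homog (wdeg w + e) (D (sprod w)) &
      forall X : Sbar, comul (D X) =
        tens_map D id (comul X) + tens_map (Sbar_sign e) D (comul X)].

(* D is the coderivation of degree e corresponding to f in Hom(Sbar(V), V),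
   f being given on products of homogeneous elements. *)
Definition coder_lift (e : int) (f : word V -> V) (D : Sbar -> Sbar) : Prop :=
  coderivation e D /\ forall w : word V, w <> [::] -> corestr (D (sprod w)) = f w.

Definition gcomm (a b : int) (D E : Sbar -> Sbar) : Sbar -> Sbar :=
  fun X => D (E X) - sgn (a * b) *: E (D X).

(* E = e^{[., T]} Phi, Phi of degree 1 and T of degree 0; on each X the series
   is a finite sum. *)
Definition exp_comm (Phi T E : Sbar -> Sbar) : Prop :=
  forall X : Sbar, exists N : nat, forall m : nat, (N <= m)%N ->
    \sum_(k < m) (k`!%:R : K)^-1 *: iter k (fun Z => gcomm 1 0 Z T) Phi X = E X.

End SymCoalgebra.

Section RotaBaxter.
Variables g h : gvect K.

Definition total_bracket (l : seq g -> g) (R : seq g -> seq h -> h)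
    (w : word (dsum g h)) : dsum g h :=
  let k := size w in
  let x := tnth (in_tuple w) in
  (l (map fst (vals w)),
   \sum_(0 <= i < k.+1) \sum_(s : 'S_k | shuffle [:: i; k - i]%N s)
     koszul x s *:
       (let xs := vals (pword x s) in
        R (map fst (take i xs)) (map snd (drop i xs)))).

(* Hom(Sbar(h), g) inside Hom(Sbar(g (+) h), g (+) h) *)
Definition ext_H (Theta : seq h -> g) (w : word (dsum g h)) : dsum g h :=
  (Theta (map snd (vals w)), 0).

(* the component in Hom(Sbar(h), g) *)
Definition proj_H (D : Sbar (dsum g h) -> Sbar (dsum g h)) (w : word h) : g :=
  (corestr (D (sprod (map (@hinr g h) w)))).1.

Definition homotopy_Rota_Baxter (l : seq g -> g) (R : seq g -> seq h -> h)
    (Theta : seq h -> g) : Prop :=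
  [/\ multisym Theta, has_degree 0 Theta &
   exists Phi T E : Sbar (dsum g h) -> Sbar (dsum g h),
   [/\ coder_lift 1 (total_bracket l R) Phi, coder_lift 0 (ext_H Theta) T,
       exp_comm Phi T E & forall w : word h, w <> [::] -> proj_H E w = 0]].

(* The defining formula of M_{p,q} for p, q >= 1; c = (i_1, .., i_k) runs over
   the compositions of p, and the last q arguments vs need not be homogeneous. *)
Definition post_Lie_formula (R : seq g -> seq h -> h) (Theta : seq h -> g)
    (p : nat) (u : 'I_p -> helt h) (vs : seq h) : h :=
  \sum_(1 <= k < p.+1)
  \sum_(c : k.-tuple 'I_p.+1 |
          (sumn (map val c) == p) && all (fun i : 'I_p.+1 => (0 < i)%N) c)
  \sum_(s : 'S_p | shuffle (map val c) s)
    (koszul u s / k`!%:R) *: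
      R (map Theta (reshape (map val c) (vals (pword u s)))) vs.

End RotaBaxter.
End Graded.

(* [corestr], [Sbar_sign] and [comul] respect the relations of Sbar. *)
Section WellDefined.
Variable K : fieldType.
Variable V : gvect K.

Lemma class0 (T : choiceType) rel : @pres_class K T rel 0 = 0.
Proof. by have := pres_class_linear rel (-1) 0 0; rewrite !scaleN1r oppr0 addr0 addNr. Qed.

Lemma sprod_nil : sprod ([::] : word V) = 0.
Proof.
rewrite /sprod /pres_gen -[RHS](class0 (@sym_rel K V)); apply: pres_class_rel.
rewrite subr0; exact: sym_nil.
Qed.

Lemma sprod_lin (w1 w2 : word V) a x y z : hdeg z = hdeg x -> hdeg z = hdeg y ->
  hval z = a *: hval x + hval y ->
  sprod (w1 ++ z :: w2) = a *: sprod (w1 ++ x :: w2) + sprod (w1 ++ y :: w2).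
Proof.
move=> *; rewrite /sprod /pres_gen -pres_class_linear; apply: pres_class_rel; exact: sym_lin.
Qed.

Lemma sprod_comm (w1 w2 : word V) x y :
  sprod (w1 ++ x :: y :: w2) = sgn K (hdeg x * hdeg y) *: sprod (w1 ++ y :: x :: w2).
Proof.
have := pres_class_linear (@sym_rel K V) (sgn K (hdeg x * hdeg y)) << w1 ++ y :: x :: w2 : word V >> 0.
rewrite !class0 !addr0 => <-; apply: pres_class_rel; exact: sym_comm.
Qed.

Lemma sym_lift (W : lmodType K) (phi : word V -> W) :
  phi [::] = 0 ->
  (forall w1 w2 a x y z, hdeg z = hdeg x -> hdeg z = hdeg y -> hval z = a *: hval x + hval y ->
     phi (w1 ++ z :: w2) = a *: phi (w1 ++ x :: w2) + phi (w1 ++ y :: w2)) ->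
  (forall w1 w2 x y, phi (w1 ++ x :: y :: w2) = sgn K (hdeg x * hdeg y) *: phi (w1 ++ y :: x :: w2)) ->
  forall x, sym_rel x -> linext phi x = 0.
Proof.
move=> p0 pl pc.
pose L := linext phi; have lL : linear L := @linext_linear _ _ _ phi.
have LB u v : L (u - v) = L u - L v.
  by rewrite -[u - v]addrC -(scaleN1r v) lL scaleN1r addrC.
have LZ a u : L (a *: u) = a *: L u.
  have := LB u u; rewrite !subrr => L0.
  by rewrite -[a *: u]addr0 lL L0 addr0.
move=> _ [|w1 w2 a x y z e1 e2 e3|w1 w2 x y]; rewrite -/L ?LB ?lL ?LZ /L !linext_gen //.
  by rewrite (pl _ _ _ _ _ _ e1 e2 e3) subrr.
by rewrite -pc subrr.
Qed.

Lemma corestr_rel x : sym_rel x ->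
  linext (fun w : word V => if w is [:: x] then hval x else 0) x = 0.
Proof.
apply: sym_lift => //.
  by case=> [|? [|? ?]] [|? ?] a x1 y z _ _ //= e; rewrite ?e ?scaler0 ?addr0.
by case=> [|? [|? ?]] w2 x1 y /=; rewrite scaler0.
Qed.

Lemma wdeg_cat (w1 w2 : word V) : wdeg (w1 ++ w2) = wdeg w1 + wdeg w2.
Proof. exact: big_cat. Qed.
Lemma wdeg_cons x (w2 : word V) : wdeg (x :: w2) = hdeg x + wdeg w2.
Proof. exact: big_cons. Qed.

Lemma Sbar_sign_rel e x : sym_rel x ->
  linext (fun w : word V => sgn K (e * wdeg w) *: sprod w) x = 0.
Proof.
apply: sym_lift; first by rewrite sprod_nil scaler0.
  move=> w1 w2 a x' y z e1 e2 e3; rewrite (sprod_lin _ _ e1 e2 e3) !wdeg_cat !wdeg_cons -e1 -e2.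
  by rewrite scalerDr !scalerA mulrC.
move=> w1 w2 x' y; rewrite sprod_comm !wdeg_cat !wdeg_cons !scalerA mulrC.
by rewrite [hdeg x' + (_ + _)]addrCA.
Qed.

Lemma shuffle2P (i n : nat) (s : 'S_n) : (i <= n)%N ->
  reflect (forall a b : 'I_n, (a < b)%N -> ((a < i)%N = (b < i)%N) -> (s a < s b)%N)
          (shuffle [:: i; (n - i)%N] s).
Proof.
move=> lein; rewrite /shuffle /=.
set w := [seq _ | _ <- _]; have sw : size w = n by rewrite size_map size_enum_ord.
have -> : take (n - i) (drop i w) = drop i w by rewrite take_oversize // size_drop sw.
have wE (a : 'I_n) : nth 0%N w a = s a.
  by rewrite (nth_map a) ?size_enum_ord ?ltn_ord // nth_ord_enum.
rewrite andbT; apply: (iffP andP) => [[S1 S2] a b ab|H].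
  have bn := ltn_ord b.
  case: (ltnP b i) => bi abi.
    have := sorted_ltn_nth ltn_trans 0%N S1 a b; rewrite !inE size_take sw !nth_take ?abi // !wE.
    by apply=> //; case: ifP; lia.
  have := sorted_ltn_nth ltn_trans 0%N S2 (a - i)%N (b - i)%N; rewrite !inE size_drop sw !nth_drop.
  by rewrite !subnKC //; [rewrite !wE; apply; lia | lia].
split; apply/(sortedP 0%N) => j; rewrite ?size_take ?size_drop sw => jl.
  have jn : (j.+1 < n)%N by move: jl; case: ifP; lia.
  rewrite !nth_take; try by move: jl; case: ifP; lia.
  have := H (Ordinal (ltnW jn)) (Ordinal jn); rewrite -!wE /=; apply=> //.
  by move: jl; case: ifP; lia.
rewrite !nth_drop; have jn : (i + j.+1 < n)%N by lia.
have jn' : (i + j < n)%N by lia.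
by have := H (Ordinal jn') (Ordinal jn); rewrite -!wE /=; apply; lia.
Qed.

Lemma sgn_sq d : sgn K d * sgn K d = 1.
Proof.
rewrite /sgn -exprzDr ?unitrN1 //.
have -> : d + d = 2 * d :> int by lia.
by rewrite -exprz_exp [(-1) ^ _](_ : _ = 1) ?exp1rz // -exprnP expr2 mulrNN mulr1.
Qed.

Lemma koszulV n (x : 'I_n -> helt V) (s : 'S_n) :
  koszul x s = \prod_(q : 'I_n * 'I_n | (q.2 < q.1)%N && ((s^-1)%g q.1 < (s^-1)%g q.2)%N)
     sgn K (hdeg (x q.1) * hdeg (x q.2)).
Proof.
rewrite /koszul pair_big_dep /=.
rewrite (reindex_inj (h := fun q : 'I_n * 'I_n => ((s^-1)%g q.1, (s^-1)%g q.2))) /=; last first.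
  by move=> [a b] [c d] [/perm_inj -> /perm_inj ->].
by apply: eq_big => [[a b]|[a b] _] /=; rewrite !permKV // andbC.
Qed.

Section Swap.
Variables (n : nat) (k k' : 'I_n) (x : 'I_n -> helt V).
Hypothesis kk' : k' = k.+1 :> nat.
Let t := tperm k k'.
Let x' := fun i => x (t i).
Let c : K := sgn K (hdeg (x k) * hdeg (x k')).

Let tlt (a b : 'I_n) : (a, b) <> (k, k') -> (a, b) <> (k', k) -> (t a < t b)%N = (a < b)%N.
Proof.
move=> n1 n2; rewrite /t.
have e1 : ~ (a = k /\ b = k') by move=> [? ?]; apply: n1; congr pair.
have e2 : ~ (a = k' /\ b = k) by move=> [? ?]; apply: n2; congr pair.
have vE (u v : 'I_n) : (u = v) <-> (u = v :> nat) by split=> [->//|/val_inj].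
rewrite !vE in e1 e2.
have nE (u v : 'I_n) : u <> v -> u <> v :> nat by move=> h /val_inj.
by case: tpermP => [ea|ea|/nE na /nE na']; case: tpermP => [eb|eb|/nE nb /nE nb'];
   (try move: ea => /vE ea); (try move: eb => /vE eb); lia.
Qed.

Let tk : t k = k'. Proof. exact: tpermL. Qed.
Let tk' : t k' = k. Proof. exact: tpermR. Qed.
Let tt : involutive t. Proof. exact: tpermK. Qed.
Let nkk : (k', k) <> (k, k'). Proof. by case=> /(congr1 val) /=; lia. Qed.

Lemma koszul_swap (s : 'S_n) : koszul x' s = c * koszul x (s * t)%g.
Proof.
rewrite !koszulV invMg tpermV -/t.
rewrite [in RHS](reindex_inj (h := fun q : 'I_n * 'I_n => (t q.1, t q.2))) /=; last first.
  by move=> [a b] [a1 b1] [/perm_inj -> /perm_inj ->].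
under [in RHS]eq_bigl do rewrite !permM !tt.
pose P (q : 'I_n * 'I_n) := (q.2 < q.1)%N && ((s^-1)%g q.1 < (s^-1)%g q.2)%N.
pose Q (q : 'I_n * 'I_n) := (t q.2 < t q.1)%N && ((s^-1)%g q.1 < (s^-1)%g q.2)%N.
pose F (q : 'I_n * 'I_n) : K := sgn K (hdeg (x (t q.1)) * hdeg (x (t q.2))).
rewrite -[LHS]/(\prod_(q | P q) F q) -[X in _ * X]/(\prod_(q | Q q) F q).
rewrite [LHS](bigID (fun q => (q == (k', k)) || (q == (k, k')))) /=.
rewrite [X in _ = _ * X](bigID (fun q => (q == (k', k)) || (q == (k, k')))) /=.
rewrite mulrA; congr (_ * _); last first.
  apply: eq_bigl => -[a b]; rewrite /P /Q /=.
  case: ((a, b) =P (k', k)) => [_|n1]; rewrite ?andbF //=.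
  case: ((a, b) =P (k, k')) => [_|n2]; rewrite ?andbF //=.
  rewrite tlt //.
    by case=> e1 e2; apply: n1; rewrite e1 e2.
  by case=> e1 e2; apply: n2; rewrite e1 e2.
have F1 : F (k', k) = c by rewrite /F /= tk tk'.
have F2 : F (k, k') = c by rewrite /F /= tk tk' mulrC.
have neq : (s^-1)%g k <> (s^-1)%g k' :> nat.
  by move/val_inj/perm_inj/(congr1 val) => /=; lia.
case: (ltnP ((s^-1)%g k) ((s^-1)%g k')) => lt.
  rewrite [LHS]big_pred0; last first.
    move=> q; apply/negP => /andP[+ /orP[]/eqP e]; rewrite e /P /=; lia.
  rewrite (big_pred1 (k, k')) ?F2 ?sgn_sq //.
  move=> q; rewrite /Q; apply/idP/eqP => [/andP[+ /orP[]/eqP e]|->].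
  - rewrite e /= tk tk'; lia.
  - by rewrite e.
  - rewrite eqxx orbT /= tk tk'; lia.
rewrite [X in _ * X]big_pred0; last first.
  move=> q; apply/negP => /andP[+ /orP[]/eqP e]; rewrite e /Q /= tk tk'; lia.
rewrite (big_pred1 (k', k)) ?F1 ?mulr1 //.
move=> q; rewrite /P; apply/idP/eqP => [/andP[+ /orP[]/eqP e]|->].
- by rewrite e.
- rewrite e /=; lia.
- rewrite eqxx /=; lia.
Qed.

Lemma koszul_adj (s : 'S_n) : ((s^-1)%g k' = ((s^-1)%g k).+1 :> nat) ->
  koszul x (s * t)%g = c * koszul x s.
Proof.
move=> adj; rewrite !koszulV invMg tpermV -/t.
pose P (q : 'I_n * 'I_n) := (q.2 < q.1)%N && ((t * s^-1)%g q.1 < (t * s^-1)%g q.2)%N.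
pose Q (q : 'I_n * 'I_n) := (q.2 < q.1)%N && ((s^-1)%g q.1 < (s^-1)%g q.2)%N.
pose F (q : 'I_n * 'I_n) : K := sgn K (hdeg (x q.1) * hdeg (x q.2)).
rewrite -[LHS]/(\prod_(q | P q) F q) -[X in _ * X]/(\prod_(q | Q q) F q).
have Pk : P (k', k) by rewrite /P /= !permM tk tk' adj kk' !ltnSn.
have F1 : F (k', k) = c by rewrite /F /= mulrC.
rewrite (bigD1 (k', k)) //= F1; congr (_ * _); apply: eq_bigl => -[a b].
rewrite /P /Q /= !permM.
case: ((a, b) =P (k', k)) => [[-> ->]|n1]; first by rewrite andbF /= adj [(_.+1 < _)%N]ltnNge leqnSn andbF.
rewrite andbT; case ba: (b < a)%N => //=.
have n2 : (a, b) <> (k, k') by case=> ea eb; move: ba; rewrite ea eb; lia.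
pose r (u : 'I_n) : nat := (s^-1)%g u.
have adj' : r k' = (r k).+1 := adj.
have inj (u v : 'I_n) : u <> v -> r u <> r v.
  by move=> uv /val_inj/perm_inj.
change ((r (t a) < r (t b))%N = (r a < r b)%N).
have e1 : ~ (a = k /\ b = k') by move=> [? ?]; apply: n2; congr pair.
have e2 : ~ (a = k' /\ b = k) by move=> [? ?]; apply: n1; congr pair.
clearbody r; rewrite /t; case: tpermP => [ea|ea|na na']; case: tpermP => [eb|eb|nb nb'] //.
- by move: ba; rewrite ea eb ltnn.
- by case: e1.
- by rewrite ea; have := inj _ _ nb; have := inj _ _ nb'; lia.
- by case: e2.
- by move: ba; rewrite ea eb ltnn.
- by rewrite ea; have := inj _ _ nb; have := inj _ _ nb'; lia.
- by rewrite eb; have := inj _ _ na; have := inj _ _ na'; lia.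
- by rewrite eb; have := inj _ _ na; have := inj _ _ na'; lia.
Qed.

Lemma pword_swap (s : 'S_n) : pword x' s = pword x (s * t)%g.
Proof. by apply: eq_map => i; rewrite permM. Qed.

Lemma pword_adj (s : 'S_n) : ((s^-1)%g k' = ((s^-1)%g k).+1 :> nat) ->
  exists A B : word V, [/\ size A = (s^-1)%g k, pword x s = A ++ x k :: x k' :: B
    & pword x' s = A ++ x k' :: x k :: B].
Proof.
set p := (s^-1)%g k; set p' := (s^-1)%g k' => adj.
have sp : s p = k by rewrite permKV. have sp' : s p' = k' by rewrite permKV.
exists [seq x (s i) | i <- take p (enum 'I_n)], [seq x (s i) | i <- drop p.+2 (enum 'I_n)].
have pn := ltn_ord p'.
have eE : enum 'I_n = take p (enum 'I_n) ++ p :: p' :: drop p.+2 (enum 'I_n).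
  rewrite -{1}[enum 'I_n](cat_take_drop p); congr (_ ++ _).
  rewrite (drop_nth p) ?size_enum_ord //; rewrite nth_ord_enum; congr (_ :: _).
  by rewrite (drop_nth p) ?size_enum_ord; rewrite -?adj // nth_ord_enum.
have nn i : i \in take p (enum 'I_n) ++ drop p.+2 (enum 'I_n) -> x' (s i) = x (s i).
  have : uniq ([:: p; p'] ++ (take p (enum 'I_n) ++ drop p.+2 (enum 'I_n))).
    by rewrite -(perm_uniq (permEl (perm_catCA _ [:: p; p'] _))) /= -eE enum_uniq.
  rewrite cat_cons /= inE negb_or => /and3P[/andP[_ np] np' _] ii.
  rewrite /x' /t tpermD //; rewrite -?sp -?sp' (inj_eq perm_inj).
    by apply: contraNneq np => e; rewrite {1}e.
  by apply: contraNneq np' => e; rewrite {1}e.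
split.
- by rewrite size_map size_take size_enum_ord ltn_ord.
- by rewrite /pword {1}eE map_cat /= sp sp'.
- rewrite /pword {1}eE map_cat /= {2 3}/x' sp sp' tk tk'; congr (_ ++ _ :: _ :: _).
    by apply/eq_in_map => i ii; apply: nn; rewrite mem_cat ii.
  by apply/eq_in_map => i ii; apply: nn; rewrite mem_cat ii orbT.
Qed.

Lemma not_shuffle_adj i (s : 'S_n) : (i <= n)%N ->
  shuffle [:: i; (n - i)%N] s -> ~~ shuffle [:: i; (n - i)%N] (s * t)%g ->
  ((s^-1)%g k' = ((s^-1)%g k).+1 :> nat) /\ i <> (s^-1)%g k' :> nat.
Proof.
move=> lein /(shuffle2P _ lein) sh nsh.
set p := (s^-1)%g k; set p' := (s^-1)%g k'.
have sp : s p = k by rewrite permKV. have sp' : s p' = k' by rewrite permKV.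
have [ab|nab] := boolP [exists a : 'I_n, exists b : 'I_n,
   [&& (a < b)%N, (a < i)%N == (b < i)%N & (t (s b) <= t (s a))%N]]; last first.
  case/negP: nsh; apply/shuffle2P => // a b ab ai.
  rewrite !permM ltnNge; apply/negP => H; case/negP: nab.
  by apply/existsP; exists a; apply/existsP; exists b; rewrite ab ai eqxx.
case/existsP: ab => a /existsP[b] /and3P[ab /eqP ai tba].
have sab := sh _ _ ab ai.
have [ea eb] : s a = k /\ s b = k'.
  case: (altP (s a =P k)) => [ea|na]; case: (altP (s b =P k')) => [eb|nb] //.
  - have := tlt (a := s a) (b := s b); case/boolP: (s b == k').
      by rewrite (negPf nb).
    move=> _ H; move: tba; rewrite leqNgt H ?sab //; first by case=> _ e; rewrite e eqxx in nb.
    by case=> e _; move: e; rewrite ea => /(congr1 val) /=; lia.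
  - move: tba; rewrite leqNgt tlt ?sab //; first by case=> e _; rewrite e eqxx in na.
    by case=> _ e; move: e; rewrite eb => /(congr1 val) /=; lia.
  - move: tba; rewrite leqNgt tlt ?sab //; first by case=> e _; rewrite e eqxx in na.
    by case=> e1 e2; move: sab; rewrite e1 e2; lia.
have pa : p = a by apply: (@perm_inj _ s); rewrite sp.
have pb : p' = b by apply: (@perm_inj _ s); rewrite sp'.
rewrite pa pb; split; last by lia.
apply/eqP; rewrite eqn_leq ab andbT leqNgt; apply/negP => lt.
have cn : (a.+1 < n)%N by have := ltn_ord b; lia.
pose cc := Ordinal cn.
have h1 : (s a < s cc)%N by apply: sh => /=; lia.
have h2 : (s cc < s b)%N by apply: sh => /=; lia.
move: h1 h2; rewrite ea eb; lia.
Qed.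

Lemma comul_word_swap : comul_word x' = c *: comul_word x.
Proof.
rewrite /comul_word scaler_sumr; apply: eq_big_nat => i /andP[_ ltin].
have lein := ltnW ltin.
pose sh := @shuffle [:: i; (n - i)%N] n.
pose J (s : 'S_n) := if sh s && sh (s * t)%g then (s * t)%g else s.
have stt (s : 'S_n) : (s * t * t)%g = s by rewrite -mulgA tperm2 mulg1.
have JJ : involutive J.
  by move=> s; rewrite {2}/J; case: ifP => /= H; rewrite /J ?stt ?[sh _ && sh s]andbC H.
have shJ s : sh (J s) = sh s by rewrite /J; case: ifP => // /andP[-> ->].
rewrite scaler_sumr [RHS](reindex_inj (inv_inj JJ)) /=.
apply: eq_big => [s|s shs]; first by rewrite -[LHS]shJ.
have shs1 : sh s := shs.
rewrite /J shs1 /=; case: ifP => [_|/negbT nsh].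
  by rewrite pword_swap koszul_swap scalerA.
have [adj ni] := not_shuffle_adj lein shs nsh.
have -> : koszul x' s = koszul x s.
  have e1 := koszul_swap s; have e2 := koszul_adj adj.
  by rewrite e1 e2 mulrA sgn_sq mul1r.
have [A [B [sA -> ->]]] := pword_adj adj.
rewrite scalerA mulrC -scalerA; congr (_ *: _).
have tZl a u v : tens (a *: u) v = a *: tens u v :> tensor (Sbar V) (Sbar V).
  have := tens_linl (1) u (- u) v; rewrite scale1r subrr => h.
  have t0 : tens (0 : Sbar V) v = 0.
    have := tens_linl (-1) (0 : Sbar V) 0 v; by rewrite scaler0 addr0 scaleN1r addNr.
  by rewrite -[a *: u]addr0 tens_linl t0 addr0.
have tZr a u v : tens u (a *: v) = a *: tens u v :> tensor (Sbar V) (Sbar V).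
  have t0 : tens u (0 : Sbar V) = 0 :> tensor (Sbar V) (Sbar V).
    have := tens_linr (-1) u (0 : Sbar V) 0; by rewrite scaler0 addr0 scaleN1r addNr.
  by rewrite -[a *: v]addr0 tens_linr t0 addr0.
have cc : c = sgn K (hdeg (x k') * hdeg (x k)) by rewrite /c mulrC.
have iA : i <> (size A).+1 by rewrite sA -adj.
rewrite !take_cat !drop_cat; case: ltnP => iA'.
  by rewrite sprod_comm tZr cc.
case E: (i - size A)%N => [|[|j]] /=.
- by rewrite (sprod_comm [::]) tZr cc.
- lia.
- by rewrite sprod_comm tZl cc.
Qed.
End Swap.

Section Lin.
Variables (n : nat) (k : 'I_n) (x y z : 'I_n -> helt V) (a : K).
Hypotheses (exz : forall i, i != k -> x i = z i) (eyz : forall i, i != k -> y i = z i).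
Hypotheses (dx : hdeg (z k) = hdeg (x k)) (dy : hdeg (z k) = hdeg (y k)).
Hypothesis ez : hval (z k) = a *: hval (x k) + hval (y k).

Lemma pword_at (s : 'S_n) : exists A B : word V,
  [/\ pword z s = A ++ z k :: B, pword x s = A ++ x k :: B & pword y s = A ++ y k :: B].
Proof.
set p := (s^-1)%g k; have sp : s p = k by rewrite permKV.
exists [seq z (s i) | i <- take p (enum 'I_n)], [seq z (s i) | i <- drop p.+1 (enum 'I_n)].
have eE : enum 'I_n = take p (enum 'I_n) ++ p :: drop p.+1 (enum 'I_n).
  rewrite -{1}[enum 'I_n](cat_take_drop p); congr (_ ++ _).
  by rewrite (drop_nth p) ?size_enum_ord //; rewrite nth_ord_enum.
have nn i : i \in take p (enum 'I_n) ++ drop p.+1 (enum 'I_n) -> s i != k.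
  have : uniq ([:: p] ++ (take p (enum 'I_n) ++ drop p.+1 (enum 'I_n))).
    by rewrite -(perm_uniq (permEl (perm_catCA _ [:: p] _))) /= -eE enum_uniq.
  move=> /= /andP[np _] ii; rewrite -sp (inj_eq perm_inj).
  by apply: contraNneq np => e; rewrite -{1}e.
split; rewrite /pword {1}eE map_cat /= sp //; congr (_ ++ _ :: _);
  apply/eq_in_map => i ii; rewrite ?exz ?eyz //; apply: nn; rewrite mem_cat ii ?orbT //.
Qed.

Lemma comul_word_lin : comul_word z = a *: comul_word x + comul_word y.
Proof.
rewrite /comul_word scaler_sumr -big_split; apply: eq_bigr => i _.
rewrite scaler_sumr -big_split; apply: eq_bigr => s _ /=.
have dE (u : 'I_n -> helt V) : (forall i, i != k -> u i = z i) -> hdeg (z k) = hdeg (u k) ->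
    koszul u s = koszul z s.
  move=> eu du; apply: eq_bigr => i1 _; apply: eq_bigr => j1 _.
  have h i2 : hdeg (u i2) = hdeg (z i2) by case: (altP (i2 =P k)) => [->//|/eu ->].
  by rewrite !h.
rewrite (dE x) // (dE y) // scalerA mulrC -scalerA -scalerDr; congr (_ *: _).
have [A [B [-> -> ->]]] := pword_at s.
rewrite !take_cat !drop_cat; case: ltnP => iA.
  by rewrite (sprod_lin _ _ dx dy ez) tens_linr.
case: (i - size A)%N => [|j] /=.
  by rewrite (sprod_lin [::] _ dx dy ez) tens_linr.
by rewrite (sprod_lin _ _ dx dy ez) tens_linl.
Qed.
End Lin.

Lemma comul_wordE (x0 : helt V) (w : word V) n : size w = n ->
  comul_word (tnth (in_tuple w)) = comul_word (fun i : 'I_n => nth x0 w i).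
Proof.
move=> <-; congr comul_word; apply/funext => i; exact: tnth_nth.
Qed.

Lemma comul_rel r : sym_rel r ->
  linext (fun w : word V => comul_word (tnth (in_tuple w))) r = 0.
Proof.
apply: sym_lift; first by rewrite /comul_word big_geq.
  move=> w1 w2 a x y z ex ey e.
  have sz u : size (w1 ++ u :: w2) = (size w1 + (size w2).+1)%N by rewrite size_cat.
  rewrite !(comul_wordE x (sz _)).
  have kl : (size w1 < size w1 + (size w2).+1)%N by lia.
  apply: (@comul_word_lin _ (Ordinal kl)) => /=.
  - by move=> i; rewrite -val_eqE /= => ni; rewrite !nth_cat; case: ltnP => // ?; case E: (i - size w1)%N => //; lia.
  - by move=> i; rewrite -val_eqE /= => ni; rewrite !nth_cat; case: ltnP => // ?; case E: (i - size w1)%N => //; lia.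
  - by rewrite !nth_cat ltnn subnn.
  - by rewrite !nth_cat ltnn subnn.
  - by rewrite !nth_cat ltnn subnn.
move=> w1 w2 x y.
have sz u v : size (w1 ++ u :: v :: w2) = (size w1 + (size w2).+2)%N by rewrite size_cat.
rewrite !(comul_wordE x (sz _ _)).
have kl : (size w1 < size w1 + (size w2).+2)%N by lia.
have kl' : ((size w1).+1 < size w1 + (size w2).+2)%N by lia.
set X := (fun i : 'I__ => nth x (w1 ++ y :: x :: w2) i).
have := comul_word_swap (k := Ordinal kl) (k' := Ordinal kl') X erefl.
rewrite {2 3}/X /= !nth_cat ltnn subnn ltnNge leqnSn subSnn /= mulrC => <-.
congr comul_word; apply/funext => i; rewrite /X.
have vE (u v : 'I_(size w1 + (size w2).+2)) : (u = v) <-> (u = v :> nat) by split=> [->//|/val_inj].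
case: tpermP => [->|->|/vE na /vE nb] /=; rewrite !nth_cat.
- by rewrite ltnn subnn ltnNge leqnSn subSnn.
- by rewrite ltnn subnn ltnNge leqnSn subSnn.
by case: ltnP => // ?; move: na nb => /=; case E: (i - size w1)%N => [|[|?]] //=; lia.
Qed.

Lemma corestr_linear : linear (@corestr K V).
Proof. exact: pres_lift_linear corestr_rel. Qed.
Lemma corestr_sprod (w : word V) :
  corestr (sprod w) = if w is [:: x] then hval x else 0.
Proof. exact: (pres_lift_gen corestr_rel). Qed.

Lemma Sbar_sign_linear e : linear (@Sbar_sign K V e).
Proof. exact: pres_lift_linear (@Sbar_sign_rel e). Qed.
Lemma Sbar_sign_sprod e (w : word V) :
  Sbar_sign e (sprod w) = sgn K (e * wdeg w) *: sprod w.
Proof. exact: (pres_lift_gen (@Sbar_sign_rel e)). Qed.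

Lemma comul_linear : linear (@comul K V).
Proof. exact: pres_lift_linear comul_rel. Qed.
Lemma comul_sprod (w : word V) : comul (sprod w) = comul_word (tnth (in_tuple w)).
Proof. exact: (pres_lift_gen comul_rel). Qed.
End WellDefined.

(* Main.v *)
(* Write E w for the sum over the set partitions of a word w of h of the products of the
   Theta-images of the blocks (with Koszul signs). On symmetric functions E is the sum over
   ordered partitions into k nonempty blocks divided by k!, so M(w, v) = R(E w, v), and E is a
   coalgebra map. A coderivation is determined by its corestriction, and evaluating
   e^{[., T]} Phi with T the coderivation of Theta turns the Rota-Baxter condition into
     l(E w) = sum of Theta(M(w1, w2) w3) over the splittings of w into w1, w2, w3.
   Now insert E w into the open-closed identity: the terms R(l(..) .., v) become
   M(M(w1, w2) w3, v) by this equation and the recursion of E on the first letter M(w1, w2), and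
   the terms R(.., R(..) ..) become M(w1, M(w2, v1) v2) since E is a coalgebra map. *)

Require Import Defs.
From mathcomp Require Import all_boot all_fingroup all_algebra.
From mathcomp Require Import boolp monalg zify ring.

Set Implicit Arguments.
Unset Strict Implicit.
Unset Printing Implicit Defensive.

Import GRing.Theory.
Local Open Scope ring_scope.

(** * Signed unshuffles and set partitions *)

(** Two descriptions of E are needed. Splitting off the block of the first letter is free of
    denominators and gives both the coalgebra property and the step with first letter M(w1, w2), but
    it hides the symmetry in w. The sum over ordered partitions shows the symmetry and matches the
    formula for M. Characteristic zero identifies them: the block of the first letter has k possible
    positions, and k/k! = 1/(k-1)!. The exponential is tamed by the projection to g. Since T
    produces letters of g and Theta vanishes on them, every term of an iterated commutator with two
    T to the left of Phi disappears; what remains is Phi e^T - T Phi e^T, because again k/k! =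
    1/(k-1)!. Signs are confined to one recursive unshuffling of words, after which coassociativity
    and cocommutativity do the work. Sums over shuffle permutations are translated into it on words
    of indices, whose letters are distinct. Empty arguments matter at the end: the vanishing of
    R_{p,0} for an action removes the terms M(w1, w2) with w2 empty, which a post-Lie structure does
    not have. *)

Section SignedUnshuffles.
Variable K : fieldType.
Implicit Types (W : lmodType K) (d e : int).

Lemma sgnD d e : sgn K (d + e) = sgn K d * sgn K e.
Proof. by rewrite /sgn exprzDr ?unitrN1. Qed.

Lemma sgn0 : sgn K 0 = 1.
Proof. by []. Qed.

Lemma sgn_double d : sgn K (d + d) = 1.
Proof. by rewrite sgnD sgn_sq. Qed.

Lemma sgn_eq d e c : d = e + (c + c) -> sgn K d = sgn K e.
Proof. by move=> ->; rewrite sgnD sgn_double mulr1. Qed.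

Definition lc (A : Type) W (r : seq (K * A)) (F : A -> W) : W :=
  \sum_(p <- r) p.1 *: F p.2.

Section Lc.
Variables (A : Type) (W : lmodType K).
Implicit Types (r : seq (K * A)) (F G : A -> W).

Lemma lc_ext r F G : F =1 G -> lc r F = lc r G.
Proof. by move=> e; apply: eq_bigr => p _; rewrite e. Qed.

Lemma lc0 r : lc r (fun=> 0 : W) = 0.
Proof. by rewrite /lc big1 // => p _; rewrite scaler0. Qed.

Lemma lcD r F G : lc r (fun a => F a + G a) = lc r F + lc r G.
Proof. by rewrite /lc -big_split; apply: eq_bigr => p _; rewrite scalerDr. Qed.

Lemma lcZ r F c : lc r (fun a => c *: F a) = c *: lc r F.
Proof. by rewrite /lc scaler_sumr; apply: eq_bigr => p _; rewrite !scalerA mulrC. Qed.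

Lemma lc_linear (W' : lmodType K) (L : W -> W') r F : linear L ->
  L (lc r F) = lc r (fun a => L (F a)).
Proof.
move=> lL; rewrite /lc.
have L0 : L 0 = 0 by have := lL (-1) 0 0; rewrite !scaleN1r oppr0 addr0 addNr.
elim: r => [|p r IH]; first by rewrite !big_nil.
by rewrite !big_cons lL IH.
Qed.

Lemma lc_exchange (B : Type) r (s : seq (K * B)) (F : A -> B -> W) :
  lc r (fun a => lc s (fun b => F a b)) = lc s (fun b => lc r (fun a => F a b)).
Proof.
rewrite /lc; under eq_bigr do rewrite scaler_sumr.
rewrite exchange_big; apply: eq_bigr => q _; rewrite scaler_sumr.
by apply: eq_bigr => p _; rewrite !scalerA mulrC.
Qed.

Lemma lc_sum (I : Type) (r : seq (K * A)) (s : seq I) (P : pred I) (F : I -> A -> W) :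
  lc r (fun a => \sum_(i <- s | P i) F i a) = \sum_(i <- s | P i) lc r (F i).
Proof. by rewrite /lc exchange_big; apply: eq_bigr => p _; rewrite scaler_sumr. Qed.
End Lc.

Section Letters.
Variables (T : Type) (deg : T -> int).
Implicit Types (w a b : seq T) (x y : T).

Definition degs w : int := \sum_(x <- w) deg x.

Lemma degs_nil : degs [::] = 0. Proof. exact: big_nil. Qed.
Lemma degs_cons x w : degs (x :: w) = deg x + degs w. Proof. exact: big_cons. Qed.
Lemma degs_cat a b : degs (a ++ b) = degs a + degs b. Proof. exact: big_cat. Qed.

(** The full shuffle coproduct, empty factors included. A letter sent to the right factor passes the
    letters of the left factor, all of which follow it in the word; hence the sign. *)
Fixpoint unsh w : seq (K * (seq T * seq T)) :=
  if w is x :: w' then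
    [seq (p.1, (x :: p.2.1, p.2.2)) | p <- unsh w'] ++
    [seq (sgn K (deg x * degs p.2.1) * p.1, (p.2.1, x :: p.2.2)) | p <- unsh w']
  else [:: (1, ([::], [::]))].

Definition ush W w (F : seq T -> seq T -> W) : W :=
  lc (unsh w) (fun p => F p.1 p.2).

Section Ush.
Variable W : lmodType K.
Implicit Types (F G : seq T -> seq T -> W).

Lemma ush_nil F : ush [::] F = F [::] [::].
Proof. by rewrite /ush /lc big_seq1 scale1r. Qed.

Lemma ush_cons x w F : ush (x :: w) F =
  ush w (fun a b => F (x :: a) b) +
  ush w (fun a b => sgn K (deg x * degs a) *: F a (x :: b)).
Proof.
rewrite /ush /lc /= big_cat !big_map; congr (_ + _).
by apply: eq_bigr => p _; rewrite scalerA mulrC.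
Qed.

Lemma eq_ush w F G :
  (forall a b, degs a + degs b = degs w -> (size a + size b)%N = size w ->
     F a b = G a b) ->
  ush w F = ush w G.
Proof.
elim: w F G => [|x w IH] F G e; first by rewrite !ush_nil e ?degs_nil ?addr0.
rewrite !ush_cons; congr (_ + _); apply: IH => a b dab sab; rewrite e //.
- by rewrite !degs_cons -dab addrA.
- by rewrite /= -sab.
- by rewrite !degs_cons -dab addrCA.
- by rewrite /= -sab addnS.
Qed.

Lemma ush_ext w F G : (forall a b, F a b = G a b) -> ush w F = ush w G.
Proof. by move=> e; apply: eq_ush => a b _ _. Qed.

Lemma ush0 w : ush w (fun _ _ => 0 : W) = 0. Proof. exact: lc0. Qed.

Lemma ushD w F G : ush w (fun a b => F a b + G a b) = ush w F + ush w G.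
Proof. exact: lcD. Qed.

Lemma ushZ w F k : ush w (fun a b => k *: F a b) = k *: ush w F.
Proof. exact: lcZ. Qed.

Lemma ush_linear (W' : lmodType K) (L : W -> W') w F : linear L ->
  L (ush w F) = ush w (fun a b => L (F a b)).
Proof. exact: lc_linear. Qed.

Lemma ush_sum (I : Type) w (s : seq I) (P : pred I) (F : I -> seq T -> seq T -> W) :
  ush w (fun a b => \sum_(i <- s | P i) F i a b) = \sum_(i <- s | P i) ush w (F i).
Proof. exact: lc_sum. Qed.
End Ush.

Section Coalgebra.
Variable W : lmodType K.

(** Coassociativity: a letter sent to the third factor passes the first two, at once or one after
    the other. *)
Lemma ushA w (F : seq T -> seq T -> seq T -> W) :
  ush w (fun a c => ush a (fun a1 a2 => F a1 a2 c)) =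
  ush w (fun a1 c => ush c (fun a2 b => F a1 a2 b)).
Proof.
elim: w F => [|x w IH] F; first by rewrite !ush_nil.
rewrite !ush_cons; under ush_ext => a c do rewrite ush_cons.
under [X in _ + X = _]eq_ush => a c _ _.
  rewrite /= -ushZ; under eq_ush => a1 a2 da _ do rewrite -da mulrDr sgnD -scalerA.
  over.
under [X in _ = _ + X]ush_ext => a c do rewrite /= ush_cons scalerDr -!ushZ.
rewrite !ushD -!addrA; congr (_ + _); first exact: IH.
congr (_ + _); rewrite IH //.
Qed.

(** Graded cocommutativity: interchanging the factors interchanges the two choices for the first
    letter. *)
Lemma ushC w (F : seq T -> seq T -> W) :
  ush w F = ush w (fun a b => sgn K (degs a * degs b) *: F b a).
Proof.
elim: w F => [|x w IH] F; first by rewrite !ush_nil degs_nil mulr0 sgn0 scale1r.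
rewrite !ush_cons [LHS]addrC; congr (_ + _); rewrite IH; apply: ush_ext => a b.
  by rewrite scalerA -sgnD degs_cons; congr (sgn K _ *: _); ring.
rewrite !scalerA -sgnD degs_cons; congr (_ *: F _ _).
by apply: (@sgn_eq _ _ (- (deg x * degs a))); ring.
Qed.

Lemma ushCA w (F : seq T -> seq T -> seq T -> W) :
  ush w (fun a c => ush c (fun b c2 => F a b c2)) =
  ush w (fun a c => ush c (fun b c2 => sgn K (degs a * degs b) *: F b a c2)).
Proof.
rewrite -!ushA; apply: ush_ext => a c.
by rewrite ushC; apply: ush_ext => a1 a2; rewrite mulrC.
Qed.

(** The hypothesis leaves only the left factor to the letters of [A]; membership is phrased by a
    factorization because [T] has no equality test. The use is for letters of [g] standing in front
    of letters of [h]. *)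
Lemma ush_left A w (F : seq T -> seq T -> W) :
  (forall A1 x A2 p q1 q2, A = A1 ++ x :: A2 -> F p (q1 ++ x :: q2) = 0) ->
  ush (A ++ w) F = ush w (fun p q => F (A ++ p) q).
Proof.
elim: A F => [|x A IH] F F0 //=; rewrite ush_cons [X in _ + X](_ : _ = 0) ?addr0.
  rewrite IH // => A1 y A2 p q1 q2 e; apply: (F0 (x :: A1) _ A2); by rewrite e.
rewrite -[RHS](ush0 W (A ++ w)); apply: ush_ext => a b.
by rewrite (F0 [::] x A _ [::]) ?scaler0.
Qed.

Lemma ush_right A w (F : seq T -> seq T -> W) :
  (forall A1 x A2 p1 p2 q, A = A1 ++ x :: A2 -> F (p1 ++ x :: p2) q = 0) ->
  ush (A ++ w) F = ush w (fun p q => sgn K (degs A * degs p) *: F p (A ++ q)).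
Proof.
elim: A F => [|x A IH] F F0 /=.
  by apply: ush_ext => a b; rewrite degs_nil mul0r sgn0 scale1r.
rewrite ush_cons [X in X + _](_ : _ = 0) ?add0r; last first.
  rewrite -[RHS](ush0 W (A ++ w)); apply: ush_ext => a b.
  by rewrite (F0 [::] x A [::]).
rewrite IH.
  by apply: ush_ext => a b; rewrite scalerA -sgnD degs_cons mulrDl addrC.
by move=> A1 y A2 p1 p2 q e; rewrite (F0 (x :: A1) _ A2) ?scaler0 ?e.
Qed.

Lemma ush_only_left w (F : seq T -> seq T -> W) :
  (forall p y q, F p (y :: q) = 0) -> ush w F = F w [::].
Proof.
move=> F0; rewrite -[w]cats0 ush_left ?ush_nil ?cats0 //.
by move=> A1 x A2 p [|y q1] q2 _; rewrite /= F0.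
Qed.

Lemma ush_only_right w (F : seq T -> seq T -> W) :
  (forall y p q, F (y :: p) q = 0) -> ush w F = F [::] w.
Proof.
move=> F0; rewrite -[w]cats0 ush_right ?ush_nil ?cats0 ?degs_nil ?mulr0 ?sgn0 ?scale1r //.
by move=> A1 x A2 [|y p1] p2 q _; rewrite /= F0.
Qed.

(** If both letters go to the same factor, the hypotheses apply; the two ways of separating them are
    interchanged. *)
Lemma ush_swap_letters A x y B (F : seq T -> seq T -> W) :
  (forall p1 p2 q, F (p1 ++ x :: y :: p2) q =
     sgn K (deg x * deg y) *: F (p1 ++ y :: x :: p2) q) ->
  (forall p q1 q2, F p (q1 ++ x :: y :: q2) =
     sgn K (deg x * deg y) *: F p (q1 ++ y :: x :: q2)) ->
  ush (A ++ x :: y :: B) F = sgn K (deg x * deg y) *: ush (A ++ y :: x :: B) F.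
Proof.
elim: A F => [|z A IH] F F1 F2 /=; last first.
  rewrite !ush_cons scalerDr; congr (_ + _); rewrite IH //.
  - by move=> p1 p2 q; rewrite (F1 (z :: p1)).
  - move=> p1 p2 q; rewrite F1 !scalerA mulrC; congr (_ * _ *: _).
    by congr (sgn K (_ * _)); rewrite !(degs_cat, degs_cons); ring.
  - by move=> p q1 q2; rewrite (F2 _ (z :: q1)) !scalerA mulrC.
rewrite !ush_cons !scalerDr.
rewrite addrACA; congr ((_ + _) + (_ + _)); rewrite -ushZ; apply: ush_ext => a b.
- exact: (F1 [::]).
- rewrite !scalerA -!sgnD !degs_cons; congr (sgn K _ *: _); ring.
- rewrite !scalerA -!sgnD !degs_cons; congr (_ *: _).
  by apply: (@sgn_eq _ _ (- (deg x * deg y))); ring.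
- rewrite (F2 _ [::]) !scalerA -!sgnD /=; congr (sgn K _ *: _); ring.
Qed.

Lemma ush_lin_letter A x y z B k (F : seq T -> seq T -> W) :
  deg z = deg x -> deg z = deg y ->
  (forall p1 p2 q, F (p1 ++ z :: p2) q = k *: F (p1 ++ x :: p2) q + F (p1 ++ y :: p2) q) ->
  (forall p q1 q2, F p (q1 ++ z :: q2) = k *: F p (q1 ++ x :: q2) + F p (q1 ++ y :: q2)) ->
  ush (A ++ z :: B) F = k *: ush (A ++ x :: B) F + ush (A ++ y :: B) F.
Proof.
move=> zx zy; elim: A F => [|t A IH] F F1 F2 /=.
  rewrite !ush_cons scalerDr addrACA; congr (_ + _);
    rewrite -ushZ -ushD; apply: ush_ext => a b.
    exact: (F1 [::]).
  by rewrite (F2 _ [::]) scalerDr -zx -zy !scalerA mulrC.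
rewrite !ush_cons scalerDr addrACA; congr (_ + _); apply: IH.
- by move=> p1 p2 q; rewrite (F1 (t :: p1)).
- by move=> p q1 q2; rewrite F2.
- move=> p1 p2 q; rewrite F1 scalerDr !scalerA [k * _]mulrC.
  by rewrite !(degs_cat, degs_cons) zx -zy zx.
- by move=> p q1 q2; rewrite (F2 _ (t :: q1)) scalerDr !scalerA mulrC.
Qed.
End Coalgebra.
End Letters.

Lemma degs_map (S T : Type) (deg : T -> int) (f : S -> T) (w : seq S) :
  degs deg (map f w) = degs (deg \o f) w.
Proof. by rewrite /degs big_map. Qed.

Lemma ush_map (S T : Type) (deg : T -> int) (f : S -> T) (W : lmodType K)
    (w : seq S) (F : seq T -> seq T -> W) :
  ush deg (map f w) F = ush (deg \o f) w (fun a b => F (map f a) (map f b)).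
Proof.
elim: w F => [|x w IH] F; first by rewrite !ush_nil.
rewrite /= !ush_cons !IH; congr (_ + _); apply: ush_ext => a b.
by rewrite degs_map.
Qed.

Section Partitions.
Variables (T : Type) (deg : T -> int).
Implicit Types (w a b : seq T) (x y : T).

(** [n] is fuel: the word left after splitting off the block of the first letter is not a structural
    subterm. *)
Fixpoint parts_rec n w : seq (K * seq (seq T)) :=
  match n, w with
  | _, [::] => [:: (1, [::])]
  | n'.+1, x :: w' =>
      flatten [seq [seq (p.1 * q.1, (x :: p.2.1) :: q.2) | q <- parts_rec n' p.2.2]
              | p <- unsh deg w']
  | _, _ => [::]
  end.

(* the blocks of each set partition of w are listed in the order of their first letters *)
Definition partsum W w (F : seq (seq T) -> W) : W := lc (parts_rec (size w) w) F.

Lemma parts_recS W n x w (F : seq (seq T) -> W) :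
  lc (parts_rec n.+1 (x :: w)) F =
  ush deg w (fun a b => lc (parts_rec n b) (fun B => F ((x :: a) :: B))).
Proof.
rewrite /lc /= big_flatten big_map; apply: eq_bigr => p _.
by rewrite big_map scaler_sumr; apply: eq_bigr => q _; rewrite scalerA.
Qed.

Lemma parts_rec_fuel W n m w (F : seq (seq T) -> W) :
  (size w <= n)%N -> (size w <= m)%N -> lc (parts_rec n w) F = lc (parts_rec m w) F.
Proof.
elim: n m w F => [|n IH] [|m] [|x w] F //= wn wm.
rewrite -![X in lc X _]/(parts_rec _.+1 (x :: w)) !parts_recS.
apply: eq_ush => a b _ sab; apply: IH; lia.
Qed.

Section PartSum.
Variable W : lmodType K.
Implicit Types (F G : seq (seq T) -> W).

Lemma partsum_nil F : partsum [::] F = F [::].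
Proof. by rewrite /partsum /lc big_seq1 scale1r. Qed.

Lemma partsum_cons x w F : partsum (x :: w) F =
  ush deg w (fun a b => partsum b (fun B => F ((x :: a) :: B))).
Proof.
rewrite /partsum parts_recS; apply: eq_ush => a b _ sab.
by apply: parts_rec_fuel => //; rewrite -/(size w) -sab leq_addl.
Qed.

Lemma eq_partsum w F G :
  (forall B, degs (degs deg) B = degs deg w -> all (fun b => 0 < size b)%N B ->
     (0 < size w -> 0 < size B)%N -> F B = G B) ->
  partsum w F = partsum w G.
Proof.
have [n] := ubnP (size w); elim: n w F G => // n IH [|x w] F G wn e.
  by rewrite !partsum_nil e // !degs_nil.
rewrite !partsum_cons; apply: eq_ush => a b dab sab; apply: IH; first by move: wn => /=; lia.
move=> B dB aB _; apply: e => //; by rewrite !degs_cons dB -addrA dab.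
Qed.

Lemma partsum_ext w F G : F =1 G -> partsum w F = partsum w G.
Proof. exact: lc_ext. Qed.
End PartSum.

(* Here the first letter x of the word lies in one of two tensor factors; moving its block there
   past the other factor is what [ushCA] accounts for. [partsum] thus is a coalgebra map
   from S(T) to S(S(T)). *)
Lemma partsum_ush W w (F : seq (seq T) -> seq (seq T) -> W) :
  partsum w (fun B => ush (degs deg) B F) =
  ush deg w (fun a b => partsum a (fun A => partsum b (fun B => F A B))).
Proof.
have [n] := ubnP (size w); elim: n w F => // n IH [|x w] F wn.
  by rewrite partsum_nil !ush_nil !partsum_nil.
rewrite partsum_cons ush_cons.
under eq_ush => a b _ sab.
  under partsum_ext => B do rewrite ush_cons.
  rewrite /partsum lcD -!/(partsum _ _) !IH; try by move: wn => /=; lia.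
  over.
rewrite ushD; congr (_ + _).
  rewrite -ushA; apply: ush_ext => a b; rewrite partsum_cons; apply: ush_ext => a1 a2.
  by rewrite /partsum lc_exchange.
rewrite ushCA; apply: ush_ext => c d.
under [X in _ = _ *: X]partsum_ext => A do rewrite partsum_cons.
rewrite /partsum -lc_exchange -lcZ; apply: lc_ext => p; rewrite -/(partsum _ _) -/(partsum _ _).
rewrite -[in LHS]lcZ -[in RHS]lcZ; apply: eq_partsum => A dA _ _.
rewrite -!lcZ; apply: lc_ext => B; rewrite !scalerA -!sgnD degs_cons dA; congr (_ *: _).
by apply: (@sgn_eq _ _ (degs deg c * degs deg p.1)); ring.
Qed.

(** The iterated coproduct with [k] factors, some possibly empty; for [k = 0] it is the counit. *)
Fixpoint unshk k w : seq (K * seq (seq T)) :=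
  if k is k'.+1 then
    flatten [seq [seq (p.1 * q.1, p.2.1 :: q.2) | q <- unshk k' p.2.2] | p <- unsh deg w]
  else if w is [::] then [:: (1, [::])] else [::].

Definition ushk W k w (F : seq (seq T) -> W) : W := lc (unshk k w) F.

Section Ushk.
Variable W : lmodType K.
Implicit Types (F G : seq (seq T) -> W).

Lemma ushk0 w F : ushk 0 w F = if w is [::] then F [::] else 0.
Proof. by case: w => [|x w]; rewrite /ushk /lc ?big_seq1 ?scale1r ?big_nil. Qed.

Lemma ushkS k w F :
  ushk k.+1 w F = ush deg w (fun a b => ushk k b (fun B => F (a :: B))).
Proof.
rewrite /ushk /lc /= big_flatten big_map; apply: eq_bigr => p _.
by rewrite big_map scaler_sumr; apply: eq_bigr => q _; rewrite scalerA.
Qed.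

Lemma eq_ushk k w F G :
  (forall B, size B = k -> degs (degs deg) B = degs deg w ->
     sumn (shape B) = size w -> F B = G B) ->
  ushk k w F = ushk k w G.
Proof.
elim: k w F G => [|k IH] w F G e.
  by rewrite !ushk0; case: w e => // e; rewrite e // !degs_nil.
rewrite !ushkS; apply: eq_ush => a b dab sab; apply: IH => B sB dB fB.
by apply: e; rewrite /= ?degs_cons ?sB ?dB ?fB.
Qed.

Lemma ushk_ext k w F G : F =1 G -> ushk k w F = ushk k w G.
Proof. exact: lc_ext. Qed.

Lemma ushk_zero k w : ushk k w (fun=> 0 : W) = 0. Proof. exact: lc0. Qed.

Lemma ushk2 w (F : seq (seq T) -> W) :
  ushk 2 w F = ush deg w (fun a b => F [:: a; b]).
Proof.
rewrite ushkS; apply: ush_ext => a b; rewrite ushkS.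
by rewrite ush_only_left => [|p y q]; rewrite ushk0.
Qed.

Lemma ushk3 w (F : seq (seq T) -> W) :
  ushk 3 w F = ush deg w (fun a b => ush deg b (fun b1 b2 => F [:: a; b1; b2])).
Proof. by rewrite ushkS; apply: ush_ext => a b; rewrite ushk2. Qed.

Definition blocks_sym F := forall (p q : seq (seq T)) a b,
  F (p ++ a :: b :: q) = sgn K (degs deg a * degs deg b) *: F (p ++ b :: a :: q).

(* By symmetry the block containing x may be moved to the front; it has k.+1 possible positions. *)
Lemma ushk_head k x w F : blocks_sym F -> ushk k.+1 (x :: w) F =
  k.+1%:R *: ush deg w (fun a b => ushk k b (fun B => F ((x :: a) :: B))).
Proof.
elim: k w F => [|k IH] w F symF; rewrite ushkS ush_cons.
  rewrite scale1r [X in _ + X](_ : _ = 0) ?addr0 //.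
  by rewrite -[RHS](ush0 deg W w); apply: ush_ext => a b; rewrite ushk0 scaler0.
rewrite mulrS scalerDl scale1r; congr (_ + _).
under ush_ext => a b.
  rewrite IH; last by move=> p q a1 b1; rewrite -!cat_cons symF.
  rewrite scalerA mulrC -scalerA -ushZ.
  over.
rewrite ushZ; congr (_ *: _).
rewrite ushCA; apply: ush_ext => a b; rewrite ushkS; apply: ush_ext => b1 b2.
rewrite -!lcZ; apply: lc_ext => B.
rewrite (symF [::]) !scalerA -!sgnD degs_cons.
rewrite -[RHS]scale1r -(sgn_double (deg x * degs deg b1 + degs deg a * degs deg b1)).
by congr (sgn K _ *: _); ring.
Qed.

Definition nonempty_blocks F (B : seq (seq T)) : W :=
  if all (fun b => 0 < size b)%N B then F B else 0.

Lemma nonempty_blocks_sym F : blocks_sym F -> blocks_sym (nonempty_blocks F).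
Proof.
move=> symF p q a b; rewrite /nonempty_blocks !all_cat /= [(0 < size a)%N && _]andbCA.
by case: ifP; rewrite ?scaler0.
Qed.

Lemma ushk_nonempty_gt k w F : (size w < k)%N -> ushk k w (nonempty_blocks F) = 0.
Proof.
move=> wk; rewrite -[RHS](ushk_zero k w); apply: eq_ushk => B sB _ fB.
rewrite /nonempty_blocks; case: ifP => // aB; exfalso.
have: (size B <= sumn (shape B))%N.
  elim: B aB {sB fB} => //= b B IH /andP[b0 /IH]; lia.
by rewrite sB fB; lia.
Qed.

(** By [ushk_head] the block of the first letter can be put in front at the cost of a factor k+1.
    This turns 1/(k+1)! into 1/k! and leaves the recursion of [partsum]. Any [N] above the length
    serves, since more factors than letters force an empty block. *)
Lemma partsum_ushk N w F : [pchar K] =i pred0 -> blocks_sym F -> (size w < N)%N ->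
  partsum w F = \sum_(k < N) (k`!%:R)^-1 *: ushk k w (nonempty_blocks F).
Proof.
move=> charK; elim: N w F => // N IH [|x w] F symF wN.
  rewrite partsum_nil big_ord_recl ushk0 /nonempty_blocks /= invr1 scale1r.
  by rewrite big1 ?addr0 // => i _; rewrite ushk_nonempty_gt ?scaler0.
rewrite partsum_cons big_ord_recl ushk0 scaler0 add0r.
under eq_bigr => k _.
  rewrite ushk_head; last exact: nonempty_blocks_sym.
  rewrite scalerA /= factS natrM invfM mulrC mulrA mulfV ?mul1r; last first.
    by rewrite (pcharf0P K).1.
  rewrite -ushZ.
  over.
rewrite -ush_sum; apply: eq_ush => a b _ sab; rewrite IH //.
- by move=> p q a1 b1; rewrite -!cat_cons symF.
- move: wN => /=; lia.
Qed.
End Ushk.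

End Partitions.
End SignedUnshuffles.

Lemma ushk_map (K : fieldType) (S T : Type) (deg : T -> int) (f : S -> T) (W : lmodType K)
    k (w : seq S) (F : seq (seq T) -> W) :
  ushk deg k (map f w) F = ushk (deg \o f) k w (fun B => F (map (map f) B)).
Proof.
elim: k w F => [|k IH] w F; first by rewrite !ushk0; case: w.
by rewrite !ushkS ush_map; apply: ush_ext => a b; rewrite IH.
Qed.

(** * Shuffle permutations *)

Section Shuffles.
Variables (K : fieldType) (n : nat) (d : 'I_n -> int).
Implicit Types (i j : 'I_n) (w a b L : seq 'I_n) (B : seq (seq 'I_n)).

(** The Koszul factor of the inversions between [a] and [L] when [a] stands to the left of [L]. *)
Definition cross_sign a L : K :=
  \prod_(i <- a) \prod_(j <- L | (j < i)%N) sgn K (d i * d j).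

Fixpoint list_sign L : K :=
  if L is i :: L' then cross_sign [:: i] L' * list_sign L' else 1.

Definition increasing w := sorted ltn (map val w).

Lemma increasing_cons i w : increasing (i :: w) = all (fun j => i < j)%N w && increasing w.
Proof.
rewrite /increasing /= path_sortedE; last exact: ltn_trans.
by rewrite all_map.
Qed.

Lemma increasing_uniq w : increasing w -> uniq w.
Proof.
move=> s; apply: (@map_uniq _ _ val); apply: sorted_uniq s; [exact: ltn_trans|exact: ltnn].
Qed.

Lemma cross_sign_cons i a L : cross_sign (i :: a) L = cross_sign [:: i] L * cross_sign a L.
Proof. by rewrite /cross_sign big_cons big_seq1. Qed.

Lemma cross_sign_cat a L1 L2 :
  cross_sign a (L1 ++ L2) = cross_sign a L1 * cross_sign a L2.
Proof.
by rewrite /cross_sign -big_split; apply: eq_bigr => i _; rewrite big_cat.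
Qed.

Lemma cross_sign_perm a L L' : perm_eq L L' -> cross_sign a L = cross_sign a L'.
Proof. by move=> e; apply: eq_bigr => i _; exact: perm_big. Qed.

Lemma cross_sign_lt i L : all (fun j => i < j)%N L -> cross_sign [:: i] L = 1.
Proof.
move=> /allP iL; rewrite /cross_sign big_seq1 big_seq_cond big1 // => j.
by case/andP=> /iL; rewrite ltnNge => /negP ij /ltnW.
Qed.

Lemma cross_sign_gt i a : all (fun j => i < j)%N a ->
  cross_sign a [:: i] = sgn K (d i * degs d a).
Proof.
elim: a => [|j a IH] /=; first by rewrite degs_nil mulr0 /cross_sign big_nil.
case/andP=> ij /IH e; rewrite cross_sign_cons e degs_cons mulrDr sgnD; congr (_ * _).
by rewrite /cross_sign big_seq1 big_cons big_nil ij mulr1 mulrC.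
Qed.

Lemma list_sign_cat a L :
  list_sign (a ++ L) = list_sign a * list_sign L * cross_sign a L.
Proof.
elim: a => [|i a IH] /=; first by rewrite /cross_sign big_nil mul1r mulr1.
rewrite IH (cross_sign_cons i a) cross_sign_cat; ring.
Qed.

Lemma list_sign_increasing w : increasing w -> list_sign w = 1.
Proof.
elim: w => //= i w IH; rewrite increasing_cons => /andP[iw /IH ->].
by rewrite cross_sign_lt ?mulr1.
Qed.

Lemma list_sign_nth i0 L : list_sign L =
  \prod_(0 <= i < size L) \prod_(0 <= j < size L | (i < j)%N && (nth i0 L j < nth i0 L i)%N)
    sgn K (d (nth i0 L i) * d (nth i0 L j)).
Proof.
elim: L => [|i L IH]; first by rewrite big_nil.
rewrite [size _]/= big_nat_recl //= IH; congr (_ * _).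
  by rewrite big_mkcond big_nat_recl //= mul1r -big_mkcond /= /cross_sign big_seq1 (big_nth i0).
apply: eq_bigr => k _; rewrite [RHS]big_mkcond big_nat_recl //= mul1r -big_mkcond.
by apply: eq_bigl => m; rewrite ltnS.
Qed.

Lemma koszul_list_sign (V : gvect K) (x : 'I_n -> helt V) (s : 'S_n) :
  (forall i, hdeg (x i) = d i) ->
  koszul x s = list_sign [seq s i | i <- enum 'I_n].
Proof.
move=> xd; set L := map _ _.
have nthL i : nth i L i = s i.
  by rewrite (nth_map i) ?size_enum_ord // nth_ord_enum.
have sL : size L = n by rewrite size_map size_enum_ord.
(* A default element for [nth] exists only for positive [n]. *)
have [n0|[i0 _]] : n = 0%N \/ exists i0 : 'I_n, True.
  by case: (posnP n) => [|n0]; [left|right; exists (Ordinal n0)].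
  rewrite /koszul big1; last by case=> m mn; exfalso; rewrite n0 in mn.
  by have /size0nil -> : size L = 0%N by rewrite sL n0.
have nE (i : 'I_n) : s i = nth i0 L i by rewrite -(nthL i); apply: set_nth_default; rewrite sL.
rewrite (list_sign_nth i0) sL big_mkord; apply: eq_bigr => i _; rewrite big_mkord.
by apply: eq_big => [j|j _]; rewrite -!nE ?xd.
Qed.

(** Together with [mem_unsh] and [uniq_unsh]: on an increasing word of indices the terms of [unsh]
    are exactly the shuffles, each once, weighted by its Koszul sign. *)
Lemma unsh_mem w p : increasing w -> p \in unsh K d w ->
  [/\ increasing p.2.1, increasing p.2.2, perm_eq (p.2.1 ++ p.2.2) w &
      p.1 = list_sign (p.2.1 ++ p.2.2)].
Proof.
elim: w p => [|i w IH] p; first by rewrite inE => _ /eqP ->.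
rewrite increasing_cons => /andP[iw sw]; rewrite /= mem_cat => /orP[] /mapP[q /(IH _ sw)[s1 s2 pq sq] ->] /=.
  have iab : all (fun j => i < j)%N (q.2.1 ++ q.2.2) by rewrite (perm_all _ pq).
  rewrite increasing_cons s1 s2 perm_cons pq cross_sign_lt // mul1r sq.
  by move: iab; rewrite all_cat => /andP[->].
have iab : all (fun j => i < j)%N (q.2.1 ++ q.2.2) by rewrite (perm_all _ pq).
move: (iab); rewrite all_cat => /andP[ia ib].
rewrite increasing_cons s1 s2 ib; split=> //.
  by rewrite -(cat1s i q.2.2) perm_catCA /= perm_cons.
rewrite sq !list_sign_cat /= -[i :: q.2.2]cat1s cross_sign_cat cross_sign_gt //.
rewrite (cross_sign_lt ib); ring.
Qed.

(** The smallest index heads the factor that contains it, which tells the branch of the recursion to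
    follow. *)
Lemma mem_unsh w a b : increasing w -> increasing a -> increasing b ->
  perm_eq (a ++ b) w -> (a, b) \in map snd (unsh K d w).
Proof.
elim: w a b => [|i w IH] a b.
  by move=> _ _ _ /perm_size; rewrite size_cat; case: a b => [|??] [|??].
rewrite increasing_cons => /andP[iw sw] sa sb pw.
rewrite /= map_cat mem_cat -!map_comp.
have head_min c : increasing c -> {subset c <= i :: w} -> i \in c ->
    c = i :: behead c.
  case: c => // j c; rewrite increasing_cons => /andP[jc _] sub.
  rewrite inE => /predU1P[-> //|ic] /=.
  have := sub j; rewrite inE eqxx => /(_ isT); rewrite inE => /predU1P[-> //|jw].
  by have := allP jc _ ic; have := allP iw _ jw; lia.
have mem_ab j : (j \in i :: w) = (j \in a) || (j \in b) by rewrite -(perm_mem pw) mem_cat.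
have := mem_ab i; rewrite inE eqxx => /esym /orP[ia|ib].
  have ea : a = i :: behead a by apply: head_min => // j ja; rewrite mem_ab ja.
  move: sa pw; rewrite ea increasing_cons /= perm_cons => /andP[_ sa] pw.
  have /mapP[q qw e] := IH _ _ sw sa sb pw.
  by apply/orP; left; apply/mapP; exists q => //=; rewrite -e.
have eb : b = i :: behead b by apply: head_min => // j jb; rewrite mem_ab jb orbT.
move: sb pw; rewrite eb increasing_cons => /andP[_ sb].
rewrite perm_catC /= perm_cons perm_catC => pw.
have /mapP[q qw e] := IH _ _ sw sa sb pw.
by apply/orP; right; apply/mapP; exists q => //=; rewrite -e.
Qed.

(** The first index lies in the left factor in one branch and in the right factor in the other, so
    no pair occurs in both. *)
Lemma uniq_unsh w : increasing w -> uniq (map snd (unsh K d w)).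
Proof.
elim: w => //= i w IH; rewrite increasing_cons => /andP[iw sw].
rewrite map_cat cat_uniq -!map_comp.
rewrite (map_comp (fun q => (i :: q.1, q.2)) snd) (map_comp (fun q => (q.1, i :: q.2)) snd).
have meml q : q \in map snd (unsh K d w) -> perm_eq (q.1 ++ q.2) w.
  by move=> /mapP[p pw ->]; have [] := unsh_mem sw pw.
move: (map snd _) (IH sw) meml => l ul meml.
rewrite !map_inj_uniq ?ul //; try by move=> [a b] [a' b'] [-> ->].
rewrite /= andbT; apply/hasPn => _ /mapP[q ql ->] /=.
apply/negP => /mapP[q' _ [e _]].
have /perm_mem/(_ i) := meml _ ql; rewrite mem_cat e inE eqxx /= => /esym iin.
by have := allP iw _ iin; rewrite ltnn.
Qed.

Lemma unshk_mem k w p : increasing w -> p \in unshk K d k w ->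
  [/\ size p.2 = k, all increasing p.2, perm_eq (flatten p.2) w & p.1 = list_sign (flatten p.2)].
Proof.
elim: k w p => [|k IH] w p sw.
  by case: w sw => // _; rewrite inE => /eqP ->.
move=> /flattenP[_ /mapP[q qw ->] /mapP[r rw ->]] /=.
have [s1 s2 pq sq] := unsh_mem sw qw.
have [sr ar pr er] := IH _ _ s2 rw.
rewrite sr s1 ar; split=> //.
  by apply: perm_trans pq; rewrite perm_cat2l.
rewrite sq er !list_sign_cat (list_sign_increasing s2) (cross_sign_perm _ pr); ring.
Qed.

Lemma mem_unshk k w B : increasing w -> size B = k -> all increasing B ->
  perm_eq (flatten B) w -> B \in map snd (unshk K d k w).
Proof.
elim: k w B => [|k IH] w [|a B] //= sw.
  by move=> _ _ /perm_size /esym /size0nil ->.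
case=> sB /andP[sa aB] pB.
have tot : total (fun i j : 'I_n => (i <= j)%N) by move=> ? ?; exact: leq_total.
(* The first unshuffle leaves the remaining indices in increasing order; the other blocks are then
   cut from that list. *)
pose b := sort (fun i j : 'I_n => (i <= j)%N) (flatten B).
have pb : perm_eq (flatten B) b by rewrite perm_sym perm_sort.
have uB : uniq (flatten B).
  have := increasing_uniq sw; rewrite -(perm_uniq pB) cat_uniq; by case/and3P.
have sb : increasing b.
  rewrite /increasing ltn_sorted_uniq_leq map_inj_uniq; last exact: val_inj.
  by rewrite -(perm_uniq pb) uB sorted_map sort_sorted.
have pab : perm_eq (a ++ b) w.
  by apply: perm_trans pB; rewrite perm_cat2l perm_sym.
have /mapP[q qw eq] := mem_unsh sw sa sb pab.
have /mapP[r rw e] := IH _ _ sb sB aB pb.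
apply/mapP; exists (q.1 * r.1, q.2.1 :: r.2); last by rewrite /= -eq -e.
apply/flattenP; exists [seq (q.1 * t.1, q.2.1 :: t.2) | t <- unshk K d k q.2.2].
  by apply: map_f.
by apply/mapP; exists r => //; rewrite -eq.
Qed.

Lemma uniq_unshk k w : increasing w -> uniq (map snd (unshk K d k w)).
Proof.
elim: k w => [|k IH] w sw /=; first by case: w sw.
rewrite map_flatten -map_comp.
have memw p := @unsh_mem w p sw; move: (uniq_unsh sw) memw.
elim: (unsh K d w) => //= q r IHr /andP[qr ur] memr.
have [_ s2 _ _] := memr q (mem_head _ _).
rewrite cat_uniq IHr ?andbT //; last by move=> p pr; apply: memr; rewrite inE pr orbT.
rewrite -map_comp (map_comp (cons q.2.1) snd) map_inj_uniq ?IH //=; last by move=> ? ? [].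
apply/hasPn => _ /flattenP[_ /mapP[q' q'r ->] /mapP[_ /mapP[t tw ->] ->]] /=.
apply/negP => /mapP[B Bw [e1 e2]].
have [|_ s2' _ _] := memr q'; first by rewrite inE q'r orbT.
have {Bw} /mapP[u uw eB] := Bw.
have [_ _ pt _] := unshk_mem s2' tw; have [_ _ pu _] := unshk_mem s2 uw.
(* A right factor is the increasing listing of the blocks cut from it, so equal blocks force equal
   right factors. *)
suff e : q'.2.2 = q.2.2.
  move/negP: qr; apply; apply/mapP; exists q' => //.
  by rewrite [q.2]surjective_pairing [q'.2]surjective_pairing e e1.
apply: (inj_map val_inj); apply: (irr_sorted_eq ltn_trans ltnn s2' s2) => m.
apply: perm_mem; apply: perm_map; rewrite perm_sym in pt; apply: perm_trans pt _.
by rewrite e2 eB.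
Qed.
End Shuffles.

Section ShuffleSums.
Variables (K : fieldType) (n : nat).

Definition perm_word (s : 'S_n) : seq 'I_n := [seq s i | i <- enum 'I_n].

Lemma perm_word_inj : injective perm_word.
Proof.
move=> s t e; apply/permP => i.
have nthE (u : 'S_n) : nth i (perm_word u) i = u i.
  by rewrite (nth_map i) ?size_enum_ord // nth_ord_enum.
by rewrite -nthE e nthE.
Qed.

Lemma perm_word_perm (s : 'S_n) : perm_eq (perm_word s) (enum 'I_n).
Proof.
apply: uniq_perm; [by rewrite map_inj_uniq ?enum_uniq //; exact: perm_inj|exact: enum_uniq|].
move=> i; rewrite mem_enum; apply/mapP; exists ((s^-1)%g i); rewrite ?mem_enum //.
by rewrite permKV.
Qed.

Lemma perm_word_surj (L : seq 'I_n) : perm_eq L (enum 'I_n) -> exists s, L = perm_word s.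
Proof.
move=> pL; have sL : size L = n by rewrite (perm_size pL) size_enum_ord.
have uL : uniq L by rewrite (perm_uniq pL) enum_uniq.
have inj : injective (fun i : 'I_n => nth i L i).
  move=> i j; rewrite (set_nth_default i j) ?sL // => /eqP.
  by rewrite nth_uniq ?sL // => /eqP /val_inj.
exists (perm inj); case: (posnP n) => [n0|n0].
  have /size0nil e1 : size L = 0%N by rewrite sL.
  have /size0nil e2 : size (perm_word (perm inj)) = 0%N by rewrite size_map size_enum_ord.
  exact: etrans e1 (esym e2).
apply: (@eq_from_nth _ (Ordinal n0)); rewrite sL; first by rewrite size_map size_enum_ord.
move=> m mn; rewrite /perm_word.
rewrite (nth_map (Ordinal n0)) ?size_enum_ord // permE.
have -> : nth (Ordinal n0) (enum 'I_n) m = Ordinal mn by rewrite -(nth_ord_enum (Ordinal n0) (Ordinal mn)).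
by apply: set_nth_default; rewrite sL.
Qed.

Lemma shuffleE c (s : 'S_n) : shuffle c s = all (@increasing n) (reshape c (perm_word s)).
Proof.
rewrite /shuffle; have -> : [seq val (s i) | i <- enum 'I_n] = map val (perm_word s).
  by rewrite /perm_word -[RHS]map_comp.
by rewrite -map_reshape all_map.
Qed.

Lemma increasing_enum : increasing (enum 'I_n).
Proof. by rewrite /increasing val_enum_ord iota_ltn_sorted. Qed.

Variables (V : gvect K) (x : 'I_n -> helt V) (W : lmodType K).

(** Cutting the word of a shuffle into blocks of sizes [c] is a bijection onto the terms of [unshk]
    of shape [c]. It is set up on words of indices, which stay distinct even if [x] takes a value
    twice. *)
Lemma shuffle_ushk (c : seq nat) (F : seq (word V) -> W) : sumn c = n ->
  \sum_(s : 'S_n | shuffle c s) koszul x s *: F (reshape c (pword x s)) =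
  ushk (@hdeg K V) (size c) (codom x) (fun B => if shape B == c then F B else 0).
Proof.
move=> sc; rewrite codomE ushk_map.
set d := _ \o x; set G := fun B : seq (seq 'I_n) => F (map (map x) B).
have szw (s : 'S_n) : size (perm_word s) = sumn c by rewrite size_map size_enum_ord.
transitivity (\sum_(B <- [seq reshape c (perm_word s) | s <- enum [pred s : 'S_n | shuffle c s]])
   list_sign K d (flatten B) *: G B).
  rewrite big_map big_enum; apply: eq_bigr => s _; rewrite reshapeKr ?szw //.
  have -> : pword x s = map x (perm_word s) by rewrite /perm_word -map_comp.
  by rewrite (@koszul_list_sign _ _ d) // /G map_reshape.
transitivity (\sum_(B <- [seq B <- map snd (unshk K d (size c) (enum 'I_n)) | shape B == c])
   list_sign K d (flatten B) *: G B); last first.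
  rewrite big_filter big_map big_mkcond /ushk /lc big_seq [RHS]big_seq.
  apply: eq_bigr => p pin; have [_ _ _ ->] := unshk_mem increasing_enum pin.
  have -> : shape (map (map x) p.2) = shape p.2.
    by rewrite /shape -map_comp; apply: eq_map => L /=; rewrite size_map.
  by case: ifP; rewrite ?scaler0.
apply: perm_big; apply: uniq_perm.
- rewrite map_inj_in_uniq ?enum_uniq // => s t _ _ e; apply: perm_word_inj.
  by rewrite -[perm_word s](reshapeKr (sh := c)) ?szw // e reshapeKr ?szw.
- by apply: filter_uniq; apply: uniq_unshk; exact: increasing_enum.
move=> B; rewrite mem_filter; apply/mapP/andP => [[s]|[/eqP sB]].
  rewrite mem_enum inE => ss ->; rewrite reshapeKl ?szw // eqxx; split=> //.
  apply: mem_unshk; rewrite ?reshapeKr ?szw ?perm_word_perm ?increasing_enum ?size_reshape //.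
  by rewrite -shuffleE.
move=> /mapP[p /(unshk_mem increasing_enum)[zp ip pp _] eB].
rewrite -{}eB in ip pp zp.
have [s es] := perm_word_surj pp.
have eB : B = reshape c (perm_word s) by rewrite -es -sB flattenK.
exists s => //; by rewrite mem_enum inE shuffleE -eB.
Qed.

Lemma shuffle2_ush (i : nat) (F : word V -> word V -> W) : (i <= n)%N ->
  \sum_(s : 'S_n | shuffle [:: i; (n - i)%N] s)
     koszul x s *: F (take i (pword x s)) (drop i (pword x s)) =
  ush (@hdeg K V) (codom x) (fun a b => if size a == i then F a b else 0).
Proof.
move=> ilen.
have sz s : size (pword x s) = n by rewrite size_map size_enum_ord.
have := shuffle_ushk (fun B => F (nth [::] B 0) (nth [::] B 1)) (c := [:: i; (n - i)%N]).
rewrite /= addn0 subnKC // => /(_ erefl).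
under eq_bigr => s _ do rewrite [take (n - i) _]take_oversize ?size_drop ?sz //.
move=> ->; rewrite ushk2; apply: eq_ush => a b _ sab /=; rewrite !eqseq_cons eqxx andbT.
have -> : (size b == n - i)%N = (size a == i).
  by move: sab; rewrite size_codom card_ord; lia.
by rewrite andbb.
Qed.

Lemma shuffles_ush (F : word V -> word V -> W) :
  \sum_(0 <= i < n.+1) \sum_(s : 'S_n | shuffle [:: i; (n - i)%N] s)
     koszul x s *: F (take i (pword x s)) (drop i (pword x s)) =
  ush (@hdeg K V) (codom x) F.
Proof.
under eq_big_nat => i ilen do rewrite shuffle2_ush //.
rewrite -ush_sum; apply: eq_ush => a b _ sab.
rewrite big_mkord (bigD1 (inord (size a))) //= inordK ?eqxx; last first.
  by move: sab; rewrite size_codom card_ord; lia.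
rewrite big1 ?addr0 // => j ne; case: ifP => // /eqP e; case/eqP: ne.
by apply/val_inj; rewrite /= inordK e.
Qed.

Lemma shuffle3_ush (i j : nat) (F : word V -> word V -> word V -> W) : (i + j <= n)%N ->
  \sum_(s : 'S_n | shuffle [:: i; j; (n - i - j)%N] s)
     koszul x s *: F (take i (pword x s)) (take j (drop i (pword x s)))
       (drop (i + j) (pword x s)) =
  ush (@hdeg K V) (codom x) (fun a r => ush (@hdeg K V) r (fun b c =>
    if (size a == i) && (size b == j) then F a b c else 0)).
Proof.
move=> ijn.
have sz s : size (pword x s) = n by rewrite size_map size_enum_ord.
have := shuffle_ushk (fun B => F (nth [::] B 0) (nth [::] B 1) (nth [::] B 2))
  (c := [:: i; j; (n - i - j)%N]).
rewrite /= addn0 => /(_ _)/=.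
have -> : (i + (j + (n - i - j)))%N = n by lia.
move=> /(_ erefl).
have dropE (p : word V) : size p = n -> take (n - i - j) (drop j (drop i p)) = drop (i + j) p.
  by move=> sp; rewrite drop_drop addnC take_oversize // size_drop sp; lia.
under eq_bigr => s _ do rewrite dropE //.
move=> ->; rewrite ushk3; apply: eq_ush => a r _ sar; apply: eq_ush => b c _ sbc /=.
rewrite !eqseq_cons eqxx andbT.
move: sar; rewrite size_codom card_ord => sar; case: (size a =P i) => //= ea.
by case: (size b =P j) => //= eb; rewrite (_ : (_ == _) = true) //; lia.
Qed.
End ShuffleSums.

(** * Linear maps, tensor products and homogeneous letters *)

Section LinearMaps.
Variables (K : fieldType) (U W : lmodType K) (f : U -> W).
Hypothesis lf : linear f.

Lemma lin0 : f 0 = 0.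
Proof. by have := lf (-1) 0 0; rewrite !scaleN1r oppr0 addr0 addNr. Qed.

Lemma linD u v : f (u + v) = f u + f v.
Proof. by have := lf 1 u v; rewrite !scale1r. Qed.

Lemma linZ k u : f (k *: u) = k *: f u.
Proof. by have := lf k u 0; rewrite lin0 !addr0. Qed.

Lemma linB u v : f (u - v) = f u - f v.
Proof. by rewrite linD -scaleN1r linZ scaleN1r. Qed.

Lemma lin_sum (I : Type) (r : seq I) (P : pred I) (F : I -> U) :
  f (\sum_(i <- r | P i) F i) = \sum_(i <- r | P i) f (F i).
Proof. exact: (big_morph f linD lin0). Qed.
End LinearMaps.

Section TensorLift.
Variables (K : fieldType) (A B W : lmodType K) (beta : A -> B -> W).
Hypotheses (betal : forall y, linear (beta^~ y)) (betar : forall x, linear (beta x)).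

Definition tens_lift : tensor A B -> W :=
  pres_lift (fun p : (A * B)%type => beta p.1 p.2).

Lemma tens_lift_rel r : @tensor_rel K A B r ->
  linext (fun p : (A * B)%type => beta p.1 p.2) r = 0.
Proof.
pose phi := (fun p : (A * B)%type => beta p.1 p.2).
pose L := linext phi; have lL : linear L := @linext_linear _ _ _ phi.
have LB k u v t : L (u - (k *: v + t)) = L u - (k *: L v + L t) by rewrite (linB lL) lL.
case=> [k u u' v|k u v v']; rewrite -/L LB /L !linext_gen /phi /=.
  by rewrite (betal v k u u') subrr.
by rewrite (betar u k v v') subrr.
Qed.

Lemma tens_lift_linear : linear tens_lift.
Proof. exact: pres_lift_linear tens_lift_rel. Qed.

Lemma tens_liftE x y : tens_lift (tens x y) = beta x y.
Proof. exact: (pres_lift_gen tens_lift_rel). Qed.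
End TensorLift.

Section HomogeneousLetters.
Variables (K : fieldType) (V : gvect K).

Fact hproj_subproof (d : int) (v : V) : homog d (hcomp d v).
Proof. by rewrite /homog hcomp_proj eqxx. Qed.

(** Projecting makes a letter of degree [d] out of every vector; a vector already of that degree is
    unchanged. *)
Definition hproj (d : int) (v : V) : helt V := Sub (d, hcomp d v) (hproj_subproof d v).

Lemma hdeg_hproj d v : hdeg (hproj d v) = d. Proof. by []. Qed.

Lemma hval_hproj d v : hval (hproj d v) = hcomp d v. Proof. by []. Qed.

Lemma homogP d (v : V) : homog d v -> hval (hproj d v) = v.
Proof. by move=> /eqP. Qed.

Lemma hprojK (x : helt V) : hproj (hdeg x) (hval x) = x.
Proof.
by case: x => -[d v] dv; apply/val_inj; have /eqP e := dv; rewrite /= /hdeg /hval /= e.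
Qed.

Lemma homog_hval (x : helt V) : homog (hdeg x) (hval x).
Proof. exact: (valP x). Qed.

Lemma homog0 d : homog d (0 : V).
Proof. by apply/eqP; apply: lin0; exact: hcomp_linear. Qed.

Lemma homog_lin d k (u v : V) : homog d u -> homog d v -> homog d (k *: u + v).
Proof. by move=> /eqP hu /eqP hv; apply/eqP; rewrite hcomp_linear hu hv. Qed.

Lemma homog_lc (A : Type) d (r : seq (K * A)) (F : A -> V) :
  (forall a, homog d (F a)) -> homog d (lc r F).
Proof.
move=> hF; rewrite /lc; elim: r => [|p r IH]; first by rewrite big_nil homog0.
by rewrite big_cons homog_lin.
Qed.

Lemma wdegE (w : word V) : wdeg w = degs (@hdeg K V) w. Proof. by []. Qed.
End HomogeneousLetters.

(** * Coderivations *)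

Section SymmetricLifts.
Variables (K : fieldType) (V : gvect K).
Implicit Types (w a b : word V) (X Y : Sbar V).

Lemma tens_linl_map (A B : lmodType K) (y : B) : linear (fun x : A => tens x y).
Proof. by move=> k x x'; exact: tens_linl. Qed.

Lemma tens_linr_map (A B : lmodType K) (x : A) : linear (fun y : B => tens x y).
Proof. by move=> k y y'; exact: tens_linr. Qed.

(** The full coproduct may replace the reduced one because the empty word is zero in [Sbar]. *)
Lemma comul_ush w :
  comul (sprod w) = ush (@hdeg K V) w (fun a b => tens (sprod a) (sprod b)).
Proof.
have tens0l Y : tens (sprod ([::] : word V)) Y = 0.
  rewrite sprod_nil; exact: (lin0 (tens_linl_map _)).
have tens0r X : tens X (sprod ([::] : word V)) = 0.
  rewrite sprod_nil; exact: (lin0 (tens_linr_map _)).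
have ew : w = codom (tnth (in_tuple w)) by rewrite codomE map_tnth_enum.
rewrite comul_sprod /comul_word [X in _ = ush _ X _]ew.
rewrite -(shuffles_ush _ (fun a b => tens (sprod a) (sprod b))).
rewrite [RHS]big_ltn // [X in X + _]big1 ?add0r => [|s _]; last first.
  by rewrite take0 tens0l scaler0.
move: (tnth (in_tuple w)) => x; case: (posnP (size w)) => [w0|w0]; first by rewrite !big_geq ?w0.
rewrite [RHS]big_nat_recr //= [X in _ + X]big1 ?addr0 // => s _.
by rewrite drop_oversize ?tens0r ?scaler0 // size_map size_enum_ord.
Qed.

(* A word of length n >= 2 has n splittings into one letter and the rest, all equal in Sbar
   after multiplication; dividing by n makes the induced map [uncomul] a left inverse of the
   coproduct in length >= 2. *)
Definition single_mul (a b : word V) : Sbar V :=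
  if (size a == 1)%N && (0 < size b)%N then (size b).+1%:R^-1 *: sprod (a ++ b) else 0.

Lemma sprod_linr a w1 w2 k x y z : hdeg z = hdeg x -> hdeg z = hdeg y ->
  hval z = k *: hval x + hval y ->
  sprod (a ++ w1 ++ z :: w2) =
  k *: sprod (a ++ w1 ++ x :: w2) + sprod (a ++ w1 ++ y :: w2).
Proof. by rewrite !catA; exact: sprod_lin. Qed.

Lemma single_mul_linr a w1 w2 k x y z : hdeg z = hdeg x -> hdeg z = hdeg y ->
  hval z = k *: hval x + hval y ->
  single_mul a (w1 ++ z :: w2) =
  k *: single_mul a (w1 ++ x :: w2) + single_mul a (w1 ++ y :: w2).
Proof.
move=> zx zy e; rewrite /single_mul !size_cat /=; case: ifP => _; last by rewrite scaler0 addr0.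
by rewrite (sprod_linr _ _ _ zx zy e) scalerDr !scalerA mulrC.
Qed.

Lemma single_mul_commr a w1 w2 x y :
  single_mul a (w1 ++ x :: y :: w2) =
  sgn K (hdeg x * hdeg y) *: single_mul a (w1 ++ y :: x :: w2).
Proof.
rewrite /single_mul !size_cat /=; case: ifP => _; last by rewrite scaler0.
by rewrite !catA sprod_comm !scalerA mulrC.
Qed.

Lemma single_mul_linl b w1 w2 k x y z : hdeg z = hdeg x -> hdeg z = hdeg y ->
  hval z = k *: hval x + hval y ->
  single_mul (w1 ++ z :: w2) b =
  k *: single_mul (w1 ++ x :: w2) b + single_mul (w1 ++ y :: w2) b.
Proof.
move=> zx zy e; rewrite /single_mul !size_cat /=; case: ifP => _; last by rewrite scaler0 addr0.
by rewrite -!catA !cat_cons (sprod_lin _ _ zx zy e) scalerDr !scalerA mulrC.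
Qed.

(** Both sides vanish: the first factor has at least two letters. *)
Lemma single_mul_comml b w1 w2 x y :
  single_mul (w1 ++ x :: y :: w2) b =
  sgn K (hdeg x * hdeg y) *: single_mul (w1 ++ y :: x :: w2) b.
Proof.
by rewrite /single_mul !size_cat /= !addnS /= scaler0.
Qed.

Lemma single_mulr_rel a r : sym_rel r -> linext (single_mul a) r = 0.
Proof.
apply: sym_lift; first by rewrite /single_mul andbF.
- by move=> *; exact: single_mul_linr.
- by move=> *; exact: single_mul_commr.
Qed.

Definition single_lift Y a := pres_lift (single_mul a) Y.

Lemma single_lift_linear a : linear (single_lift^~ a).
Proof. exact: pres_lift_linear (@single_mulr_rel a). Qed.

Lemma single_lift_sprod a b : single_lift (sprod b) a = single_mul a b.
Proof. exact: (pres_lift_gen (@single_mulr_rel a)). Qed.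

Lemma single_liftl_rel Y r : sym_rel r -> linext (single_lift Y) r = 0.
Proof.
apply: sym_lift.
- by rewrite /single_lift /pres_lift /linext big1 // => t _; rewrite scaler0.
- move=> w1 w2 k x y z zx zy e; rewrite /single_lift /pres_lift /linext scaler_sumr -big_split.
  by apply: eq_bigr => t _; rewrite (single_mul_linl _ _ _ zx zy e) scalerDr !scalerA mulrC.
- move=> w1 w2 x y; rewrite /single_lift /pres_lift /linext scaler_sumr.
  by apply: eq_bigr => t _; rewrite single_mul_comml !scalerA mulrC.
Qed.

Definition single_prod X Y : Sbar V := pres_lift (single_lift Y) X.

Lemma single_prod_linl Y : linear (single_prod^~ Y).
Proof. exact: pres_lift_linear (@single_liftl_rel Y). Qed.

Lemma single_prod_linr X : linear (single_prod X).
Proof.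
move=> k Y Z; rewrite /single_prod /pres_lift /linext scaler_sumr -big_split.
by apply: eq_bigr => t _; rewrite single_lift_linear scalerDr !scalerA mulrC.
Qed.

Lemma single_prod0l Y : single_prod 0 Y = 0.
Proof. exact: (lin0 (single_prod_linl Y)). Qed.

Lemma single_prod0r X : single_prod X 0 = 0.
Proof. exact: (lin0 (single_prod_linr X)). Qed.

Lemma single_prodE a b : single_prod (sprod a) (sprod b) = single_mul a b.
Proof. by rewrite /single_prod (pres_lift_gen (@single_liftl_rel _)) single_lift_sprod. Qed.

Definition uncomul := tens_lift single_prod.

Lemma uncomul_linear : linear uncomul.
Proof. exact: (tens_lift_linear single_prod_linl single_prod_linr). Qed.

Lemma uncomul_tens X Y : uncomul (tens X Y) = single_prod X Y.
Proof. exact: (tens_liftE single_prod_linl single_prod_linr). Qed.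

(** Putting the single letter back in its place cancels the unshuffle sign, so every choice of it
    gives the same product. The prefix [z] collects the letters already passed in the induction. *)
Lemma ush_single z w :
  ush (@hdeg K V) w (fun a b => if size a == 1%N then sprod (z ++ a ++ b) else 0) =
  (size w)%:R *: sprod (z ++ w).
Proof.
elim: w z => [|x w IH] z; first by rewrite ush_nil scale0r.
rewrite ush_cons ush_only_right => [|y p q]; last by [].
rewrite /= mulrS scalerDl scale1r; congr (_ + _).
rewrite -[z ++ x :: w](cat_rcons x z w) -IH; apply: ush_ext => -[|y [|??]] b; rewrite ?scaler0 //=.
rewrite (sprod_comm z b y x) scalerA degs_cons degs_nil addr0 [hdeg y * _]mulrC sgn_sq scale1r.
by rewrite cat_rcons.
Qed.

Hypothesis charK : [pchar K] =i pred0.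

Lemma natK_neq0 n : (n.+1%:R : K) != 0.
Proof. by rewrite (pcharf0P K).1. Qed.

Lemma uncomul_comul w : uncomul (comul (sprod w)) = if (1 < size w)%N then sprod w else 0.
Proof.
rewrite comul_ush (ush_linear _ _ _ uncomul_linear).
under ush_ext => a b do rewrite uncomul_tens single_prodE.
case: ifP => [w1|/negbT w1].
  transitivity ((size w)%:R^-1 *: ush (@hdeg K V) w
      (fun a b => if size a == 1%N then sprod ([::] ++ a ++ b) else 0)); last first.
    by rewrite ush_single scalerA mulVf ?scale1r //; case: (size w) w1 => // n _; exact: natK_neq0.
  rewrite -ushZ; apply: eq_ush => a b _ sab; rewrite /single_mul.
  case: eqP => [ea|_]; last by rewrite scaler0.
  by rewrite -sab ea /= (_ : (0 < size b)%N) //; lia.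
rewrite -[RHS](ush0 (@hdeg K V) _ w); apply: eq_ush => a b _ sab.
by rewrite /single_mul; case: eqP => //= ea; case: ifP => //; lia.
Qed.

(** Letters are homogeneous, so [V] is included in [Sbar V] one degree at a time. *)
Definition unit_map d (v : V) : Sbar V := sprod [:: hproj d v].

Lemma unit_map_linear d : linear (unit_map d).
Proof.
move=> k u v; apply: (sprod_lin [::] [::]) => //.
by rewrite !hval_hproj hcomp_linear.
Qed.

(** Words of length one survive only in the second term and longer words only in the first. An
    element is thus recovered from its coproduct and its component in [V]. *)
Lemma Sbar_decomp d X : Sbar_homog d X -> X = uncomul (comul X) + unit_map d (corestr X).
Proof.
have lc := @corestr_linear K V; have lm := @comul_linear K V.
elim=> [|k Y Z [w wd ->] _ IH].
  by rewrite (lin0 lm) (lin0 lc) (lin0 uncomul_linear) (lin0 (unit_map_linear d)) addr0.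
rewrite lm lc uncomul_linear unit_map_linear addrACA -IH -scalerDr; congr (k *: _ + _).
rewrite uncomul_comul corestr_sprod; case: w wd => [|x [|y w]] wd /=.
- by rewrite add0r (lin0 (unit_map_linear d)) sprod_nil.
- by rewrite add0r /unit_map -wd wdegE degs_cons degs_nil addr0 hprojK.
- by rewrite (lin0 (unit_map_linear d)) addr0.
Qed.

Lemma corestr_homog d X : Sbar_homog d X -> homog d (corestr X).
Proof.
elim=> [|k Y Z [w wd ->] _ IH]; first by rewrite (lin0 (@corestr_linear K V)) homog0.
rewrite corestr_linear homog_lin // corestr_sprod; case: w wd => [|x [|y w]] wd; rewrite ?homog0 //.
by rewrite -wd wdegE degs_cons degs_nil addr0 homog_hval.
Qed.
End SymmetricLifts.

Section Coderivations.
Variables (K : fieldType) (V : gvect K) (charK : [pchar K] =i pred0).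
Variables (e : int) (f : word V -> V) (D : Sbar V -> Sbar V).
Hypothesis liftD : coder_lift e f D.
Local Notation deg := (@hdeg K V).

Definition coder_letter (w : word V) : helt V := hproj (wdeg w + e) (f w).

Lemma coder_linear : linear D. Proof. by case: liftD => -[]. Qed.

Lemma coder_homog w : w <> [::] -> homog (wdeg w + e) (f w).
Proof.
case: liftD => -[_ hD _] cD w0; rewrite -cD //.
by apply: corestr_homog => //; exact: hD.
Qed.

Lemma hval_coder_letter w : w <> [::] -> hval (coder_letter w) = f w.
Proof. by move=> /coder_homog /homogP. Qed.

(** The value of [f] on the empty word is unconstrained, so the term in which [f] would receive
    nothing is set to zero. *)
Definition coder_term (p q : word V) : Sbar V :=
  if p is [::] then 0 else sprod (coder_letter p :: q).

Lemma single_prod_coder a p q : size a = 1%N ->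
  single_prod (sprod a) (coder_term p q) =
  sgn K (degs deg a * (degs deg p + e)) *:
    ((size q).+2%:R^-1 *: if p is [::] then 0 else sprod ([:: coder_letter p] ++ a ++ q)).
Proof.
case: a => [|x [|??]] // _; case: p => [|y p].
  by rewrite single_prod0r !scaler0.
rewrite /coder_term single_prodE /single_mul /= (sprod_comm [::]) !degs_cons degs_nil addr0.
by rewrite hdeg_hproj wdegE degs_cons !scalerA mulrC.
Qed.

Lemma single_prod_coder_small a p q : size a <> 1%N ->
  single_prod (sprod a) (coder_term p q) = 0.
Proof.
move=> /eqP /negPf sa; case: p => [|y p]; first exact: single_prod0r.
by rewrite /coder_term single_prodE /single_mul sa.
Qed.

(* By induction the coproduct of D (sprod w) is known, so only its component on V = S^1(V) remains
   to be determined, and that is f w. *)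
Lemma coder_sprod w : D (sprod w) = ush deg w coder_term.
Proof.
have lD := coder_linear.
have [n] := ubnP (size w); elim: n w => // n IH w wn.
case: (posnP (size w)) => [/size0nil ->|w0].
  by rewrite sprod_nil (lin0 lD) ush_nil.
have wnil : w <> [::] by move=> ew; rewrite ew in w0.
have sprod0l Y : single_prod (sprod ([::] : word V)) Y = 0.
  by rewrite sprod_nil single_prod0l.
have sprod0r X : single_prod X (sprod ([::] : word V)) = 0.
  by rewrite sprod_nil single_prod0r.
case: liftD => -[_ hD cD] cf.
rewrite [LHS](Sbar_decomp charK (hD w)) cf // cD comul_ush.
have lid : linear (@id (Sbar V)) by [].
have lTl := tens_map_linear lD lid.
have lTr := tens_map_linear (@Sbar_sign_linear K V e) lD.
rewrite (linD (@uncomul_linear K V)).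
rewrite (ush_linear _ _ _ lTl).
rewrite (ush_linear _ _ _ lTr).
(* Only the part of [D (sprod a)] of length one survives [uncomul], so [f] has consumed all of
   [a]. *)
have left_part : uncomul (ush deg w (fun a b => tens_map D id (tens (sprod a) (sprod b)))) =
    ush deg w (fun p r => if r is [::] then 0 else (size r).+1%:R^-1 *: coder_term p r).
  rewrite (ush_linear _ _ _ (@uncomul_linear K V)).
  apply: eq_ush => a b _ sab; rewrite (tens_mapE lD lid) uncomul_tens.
  case: b sab => [|y b] sab; first exact: sprod0r.
  rewrite IH; last by move: sab => /=; lia.
  rewrite (ush_linear _ _ _ (single_prod_linl _)) ush_only_left; last first.
    move=> [|z p] u q; first exact: single_prod0l.
    by rewrite /coder_term single_prodE /single_mul.
  case: a sab => [|x a] sab; first by rewrite single_prod0l scaler0.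
  by rewrite /coder_term single_prodE /single_mul.
(* Here the single letter is one that [f] leaves untouched. Each of the [size r] choices gives the
   same product once the letter is moved behind the image of [p]. *)
have right_part :
    uncomul (ush deg w (fun a b => tens_map (Sbar_sign e) D (tens (sprod a) (sprod b)))) =
    ush deg w (fun p r => ((size r)%:R / (size r).+1%:R) *: coder_term p r).
  rewrite (ush_linear _ _ _ (@uncomul_linear K V)).
  transitivity (ush deg w (fun a b => ush deg b (fun p q =>
      sgn K (e * degs deg a) *: single_prod (sprod a) (coder_term p q)))).
    apply: eq_ush => a b _ sab.
    rewrite (tens_mapE (@Sbar_sign_linear K V e) lD) uncomul_tens Sbar_sign_sprod (linZ (single_prod_linl _)) ushZ; congr (_ *: _).
    case: a sab => [|x a] sab.
      rewrite sprod0l -[LHS](ush0 deg _ b); apply: ush_ext => p q; by rewrite sprod0l.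
    by rewrite IH ?(ush_linear _ _ _ (single_prod_linr _)) //; move: sab => /=; lia.
  rewrite ushCA; apply: ush_ext => p c.
  transitivity ((size c).+1%:R^-1 *: ush deg c (fun a q =>
      if size a == 1%N then
        if p is [::] then 0 else sprod ([:: coder_letter p] ++ a ++ q) else 0)).
    rewrite -ushZ; apply: eq_ush => a q _ saq; case: (altP (size a =P 1%N)) => sa; last first.
      by rewrite single_prod_coder_small ?scaler0 //; apply/eqP.
    rewrite single_prod_coder // -saq sa !scalerA -!sgnD.
    rewrite (_ : sgn K _ = 1) ?mul1r //.
    rewrite -(sgn_double K (degs deg p * degs deg a + e * degs deg a)); congr sgn; ring.
  rewrite mulrC -scalerA; congr (_ *: _); case: p => [|y p].
    rewrite scaler0 -[RHS](ush0 deg _ c); apply: ush_ext => a q; by rewrite if_same.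
  exact: ush_single.
apply: etrans (congr2 +%R (congr2 +%R left_part right_part) erefl) _.
rewrite -[X in X + _ = _]ushD.
(* For nonempty [q] of length n the weights 1/(n+1) and n/(n+1) add up to 1; for empty [q] both
   parts give zero and the corestriction supplies the term. *)
transitivity (ush deg w (fun p q => if q is [::] then 0 else coder_term p q) +
   ush deg w (fun p q => if q is [::] then coder_term p q else 0)).
  congr (_ + _).
    apply: ush_ext => p [|y q]; first by rewrite /= mul0r scale0r addr0.
    rewrite -scalerDl -[X in X + _]mul1r -mulrDl -natr1 [1 + _]addrC mulfV ?scale1r //.
    rewrite natr1; exact: natK_neq0.
  by rewrite ush_only_left //; case: w wnil {w0 wn left_part right_part}.
by rewrite -ushD; apply: ush_ext => p [|y q]; rewrite ?add0r ?addr0.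
Qed.
End Coderivations.

(** * The Rota-Baxter equation in components *)

Section Multisym.
Variables (K : fieldType) (V : gvect K) (W : lmodType K) (f : seq V -> W).
Hypothesis symf : multisym f.

Lemma multisym_lin s1 s2 k x y :
  f (s1 ++ (k *: x + y) :: s2) = k *: f (s1 ++ x :: s2) + f (s1 ++ y :: s2).
Proof. by case: symf => + _; apply. Qed.

Lemma multisym_swap s1 s2 (x y : helt V) : f (s1 ++ hval x :: hval y :: s2) =
  sgn K (hdeg x * hdeg y) *: f (s1 ++ hval y :: hval x :: s2).
Proof. by case: symf => _; apply. Qed.

Lemma multisym_linear s1 s2 : linear (fun x => f (s1 ++ x :: s2)).
Proof. by move=> k x y; exact: multisym_lin. Qed.

Lemma multisym0 s1 s2 : f (s1 ++ 0 :: s2) = 0.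
Proof. exact: (lin0 (multisym_linear s1 s2)). Qed.
End Multisym.

Section SbarInduction.
Variables (K : fieldType) (V : gvect K).
Local Notation deg := (@hdeg K V).

Lemma Sbar_linear0 (W : lmodType K) (L : Sbar V -> W) : linear L ->
  (forall w : word V, L (sprod w) = 0) -> forall X, L X = 0.
Proof.
move=> lL L0 X; rewrite -[X]pres_reprK; move: (pres_repr X) => x.
have lc := @pres_class_linear K (word V) (@sym_rel K V).
rewrite [x]monalgE (lin_sum lc) (lin_sum lL) big1 // => w _.
have -> : << x@_w *g w >> = x@_w *: << w >>.
  by apply/malgP => u; rewrite mcoeffZ !mcoeffU mulrnAr mulr1.
by rewrite (linZ lc) (linZ lL) [L _]L0 scaler0.
Qed.

Lemma sprod_move A (x : helt V) q :
  sprod (A ++ x :: q) = sgn K (degs deg A * hdeg x) *: sprod (x :: A ++ q).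
Proof.
have H B : sprod (B ++ A ++ x :: q) = sgn K (degs deg A * hdeg x) *: sprod (B ++ x :: A ++ q).
  elim: A B => [|y A IH] B; first by rewrite degs_nil mul0r sgn0 scale1r.
  rewrite cat_cons -cat_rcons IH cat_rcons (sprod_comm B) scalerA -sgnD degs_cons.
  by congr (sgn K _ *: _); ring.
exact: (H [::]).
Qed.

Lemma sprod_val0 (x : helt V) q : hval x = 0 -> sprod (x :: q) = 0.
Proof.
move=> x0; have e : hval x = (-1) *: hval x + hval x by rewrite x0 scaler0 addr0.
rewrite (@sprod_lin _ _ [::] q (-1) x x x) //.
by rewrite scaleN1r addNr.
Qed.
End SbarInduction.

Section DirectSumWords.
Variables (K : fieldType) (g h : gvect K).

Fact hinl_subproof (x : helt g) : homog (hdeg x) ((hval x, 0) : dsum g h).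
Proof.
rewrite /homog /= /dsum_comp /=; have /eqP e := valP x; rewrite [hcomp _ (hval x)]e.
by rewrite (lin0 (@hcomp_linear K h _)).
Qed.

Definition hinl (x : helt g) : helt (dsum g h) := Sub (hdeg x, (hval x, 0)) (hinl_subproof x).

Definition mixed (A : word g) (b : word h) : word (dsum g h) :=
  map hinl A ++ map (@hinr K g h) b.

Lemma degs_hinr (b : word h) : degs (@hdeg K (dsum g h)) (map (@hinr K g h) b) = wdeg b.
Proof. by rewrite degs_map. Qed.

Lemma fst_hinl (A : word g) : map fst (vals (map hinl A)) = vals A.
Proof. by rewrite /vals -!map_comp. Qed.

Lemma snd_hinr (b : word h) : map snd (vals (map (@hinr K g h) b)) = vals b.
Proof. by rewrite /vals -!map_comp. Qed.
End DirectSumWords.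

Section RotaBaxterIdentity.
Variables (K : fieldType) (g h : gvect K) (charK : [pchar K] =i pred0).
Variables (l : seq g -> g) (R : seq g -> seq h -> h) (Theta : seq h -> g).
Hypotheses (lsym : multisym l) (Rsyml : forall us, multisym (fun xs => R xs us))
  (Rsymr : forall xs, multisym (R xs)) (R00 : R [::] [::] = 0).
Hypothesis Thetasym : multisym Theta.
Variables (Phi T E : Sbar (dsum g h) -> Sbar (dsum g h)).
Hypotheses (liftPhi : coder_lift 1 (total_bracket l R) Phi)
  (liftT : coder_lift 0 (ext_H Theta) T).
Local Notation gh := (dsum g h).
Local Notation deg := (@hdeg K gh).
Local Notation hin := (@hinr K g h).

Definition RB_letter (b : word h) : helt g := hproj (wdeg b) (Theta (vals b)).

(** A letter of [g] has [h]-component zero, and [Theta] sees only [h]-components. *)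
Lemma coder_term_hinl p1 x p2 q : coder_term 0 (ext_H Theta) (p1 ++ hinl h x :: p2) q = 0.
Proof.
have e : ext_H Theta (p1 ++ hinl h x :: p2) = 0 :> gh.
  by rewrite /ext_H /vals map_cat map_cat /= multisym0.
have -> : coder_term 0 (ext_H Theta) (p1 ++ hinl h x :: p2) q =
    sprod (coder_letter 0 (ext_H Theta) (p1 ++ hinl h x :: p2) :: q) by case: p1 {e}.
apply: sprod_val0; rewrite /coder_letter hval_hproj e.
exact: (lin0 (@hcomp_linear K gh _)).
Qed.

Lemma coder_letter_hinr b : coder_letter 0 (ext_H Theta) (map hin b) = hinl h (RB_letter b).
Proof.
apply/val_inj; rewrite /= addr0 [wdeg _]degs_hinr; congr pair.
by rewrite /dsum_comp /ext_H /= snd_hinr (lin0 (@hcomp_linear K h _)).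
Qed.

(** [T] can consume only letters of [h]. The sign of carrying a block past [A] equals that of moving
    its image back behind [A], since [Theta] has degree 0. *)
Lemma T_mixed A b : T (sprod (mixed A b)) =
  ush (@hdeg K h) b (fun b1 b2 =>
    if b1 is [::] then 0 else sprod (mixed (rcons A (RB_letter b1)) b2)).
Proof.
rewrite (coder_sprod charK liftT) /mixed ush_right; last first.
  move=> A1 x A2 p1 p2 q eA; have : x \in map (hinl h) A by rewrite eA mem_cat inE eqxx orbT.
  case/mapP=> y _ ->; exact: coder_term_hinl.
rewrite ush_map; apply: ush_ext => -[|y b1] b2; first by rewrite scaler0.
rewrite -[coder_term _ _ _ _]/(sprod (coder_letter 0 (ext_H Theta) (map hin (y :: b1)) :: _)).
rewrite coder_letter_hinr map_rcons -cats1 -catA sprod_move degs_hinr; congr (sgn K _ *: _).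
Qed.

(** The letters of [g] made by one [T] cannot be consumed by the next, so k applications choose k
    nonempty blocks in order; coassociativity gathers them in [c]. *)
Lemma T_iter k A b : iter k T (sprod (mixed A b)) =
  ush (@hdeg K h) b (fun c r => ushk (@hdeg K h) k c
    (nonempty_blocks (fun B => sprod (mixed (A ++ map RB_letter B) r)))).
Proof.
have lT := coder_linear liftT.
elim: k A b => [|k IH] A b.
  rewrite ush_only_right => [|y p q]; last by rewrite ushk0.
  by rewrite ushk0 /nonempty_blocks /= cats0.
rewrite iterSr T_mixed.
have lTk : linear (iter k T).
  elim: k {IH} => [|k IHk] //= a X Y; exact: etrans (congr1 T (IHk a X Y)) (lT _ _ _).
rewrite (ush_linear _ _ _ lTk).
under [RHS]ush_ext => c r do rewrite ushkS.
rewrite ushA; apply: ush_ext => -[|y b1] b2.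
  rewrite (lin0 lTk) -[LHS](ush0 (@hdeg K h) _ b2); apply: ush_ext => c r.
  by rewrite -[LHS](ushk_zero (@hdeg K h) _ k c).
rewrite IH; apply: ush_ext => c r; apply: ushk_ext => B.
by rewrite /nonempty_blocks /= cat_rcons.
Qed.

Definition exp_sum m X : Sbar gh := \sum_(k < m) (k`!%:R : K)^-1 *: iter k T X.

(** The factorials turn the ordered blocks of [T_iter] into set partitions. *)
Lemma exp_sum_mixed m b : (size b < m)%N -> exp_sum m (sprod (map hin b)) =
  ush (@hdeg K h) b (fun c r => partsum (@hdeg K h) c
    (fun B => sprod (mixed (map RB_letter B) r))).
Proof.
move=> bm; rewrite /exp_sum.
under eq_bigr => k _ do rewrite -[map hin b]/(mixed [::] b) T_iter -ushZ.
rewrite -ush_sum; apply: eq_ush => c r _ scr; rewrite (partsum_ushk (N := m)) //; last by lia.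
move=> p q a1 a2; rewrite !map_cat /= /mixed !map_cat /= -!catA !cat_cons.
exact: sprod_comm.
Qed.

Definition to_g (X : Sbar gh) : g := (corestr X).1.

Lemma to_g_linear : linear to_g.
Proof. by move=> a X Y; rewrite /to_g corestr_linear. Qed.

Lemma to_g_T w : w <> [::] -> to_g (T (sprod w)) = Theta (map snd (vals w)).
Proof. by move=> w0; rewrite /to_g (proj2 liftT w w0). Qed.

Lemma to_gT_linear : linear (fun X => to_g (T X)).
Proof. by move=> a X Y; rewrite (coder_linear liftT) to_g_linear. Qed.

Lemma to_g_TT X : to_g (T (T X)) = 0.
Proof.
have lT := coder_linear liftT.
apply: (@Sbar_linear0 _ _ _ (fun X => to_g (T (T X)))) => [a Y Z|w].
  by rewrite lT (to_gT_linear a).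
rewrite (coder_sprod charK liftT) (ush_linear _ _ _ to_gT_linear) -[RHS](ush0 deg _ w).
apply: ush_ext => -[|y p] q; first exact: (lin0 to_gT_linear).
rewrite to_g_T // (_ : map snd _ =
  (hval (coder_letter 0 (ext_H Theta) (y :: p))).2 :: map snd (vals q)) //.
rewrite (hval_coder_letter liftT) //; exact: (multisym0 Thetasym [::]).
Qed.

Definition ad_iter k := iter k (fun Z => gcomm 1 0 Z T) Phi.

Lemma ad_iterS k X : ad_iter k.+1 X = ad_iter k (T X) - T (ad_iter k X).
Proof. by rewrite /ad_iter iterS /gcomm mulr0 sgn0 scale1r. Qed.

(** With one [T] in front already, all others must stand to the right of [Phi] by [to_g_TT]. *)
Lemma to_g_T_ad k X : to_g (T (ad_iter k X)) = to_g (T (Phi (iter k T X))).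
Proof.
elim: k X => // k IH X.
by rewrite ad_iterS (linB (coder_linear liftT)) (linB to_g_linear) to_g_TT subr0 IH iterSr.
Qed.

(* All other terms of the iterated commutator contain T (T _), which [to_g] kills: T puts a letter
   of g in front, and Theta only accepts letters of h. *)
Lemma to_g_ad k X : to_g (ad_iter k X) =
  to_g (Phi (iter k T X)) - k%:R *: to_g (T (Phi (iter k.-1 T X))).
Proof.
elim: k X => [|k IH] X; first by rewrite scale0r subr0.
rewrite ad_iterS (linB to_g_linear) IH to_g_T_ad -!iterSr -addrA -opprD.
case: k {IH} => [|k]; first by rewrite scale0r add0r scale1r.
by rewrite -[k.+2%:R]natr1 scalerDl scale1r.
Qed.

(** Since k/k! = 1/(k-1)!, the second terms of [to_g_ad] add up to the exponential again, truncated
    one step earlier. *)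
Lemma to_g_exp m X :
  \sum_(k < m.+1) (k`!%:R : K)^-1 *: to_g (ad_iter k X) =
  to_g (Phi (exp_sum m.+1 X)) - to_g (T (Phi (exp_sum m X))).
Proof.
have lPhi := coder_linear liftPhi; have lT := coder_linear liftT.
have lg1 : linear (fun X => to_g (Phi X)) by move=> a Y Z; rewrite lPhi to_g_linear.
have lg2 : linear (fun X => to_g (T (Phi X))) by move=> a Y Z; rewrite lPhi (to_gT_linear a).
rewrite /exp_sum (lin_sum lg1) (lin_sum lg2).
under eq_bigr => k _ do rewrite to_g_ad scalerBr.
rewrite sumrB; congr (_ - _).
  by apply: eq_bigr => k _; rewrite (linZ lg1).
rewrite big_ord_recl scale0r scaler0 add0r; apply: eq_bigr => k _.
rewrite (linZ lg2) /= scalerA /bump /= add1n factS natrM invfM -mulrA mulrC -mulrA.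
by rewrite mulfV ?mulr1 // natK_neq0.
Qed.

Lemma total_bracketE w : (total_bracket l R w).2 =
  ush deg w (fun c d => R (map fst (vals c)) (map snd (vals d))).
Proof.
rewrite [X in ush _ X](_ : w = codom (tnth (in_tuple w))); last by rewrite codomE map_tnth_enum.
rewrite -shuffles_ush; apply: eq_bigr => i _; apply: eq_bigr => s _.
by rewrite /vals map_take map_drop.
Qed.

(** Letters of [g] have zero [h]-component and conversely, so a single splitting survives. *)
Lemma total_bracket_mixed A b : (total_bracket l R (mixed A b)).2 = R (vals A) (vals b).
Proof.
rewrite total_bracketE /mixed ush_left; last first.
  move=> A1 x A2 p q1 q2 eA; have : x \in map (hinl h) A by rewrite eA mem_cat inE eqxx orbT.
  by case/mapP=> y _ ->; rewrite /vals map_cat map_cat /= (multisym0 (Rsymr _)).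
rewrite ush_map ush_only_right => [|y p q].
  by rewrite cats0 fst_hinl snd_hinr.
by rewrite /vals !map_cat /= (multisym0 (Rsyml _)).
Qed.

Lemma to_g_Phi A b : mixed A b <> [::] ->
  to_g (Phi (sprod (mixed A b))) = if b is [::] then l (vals A) else 0.
Proof.
move=> nil; rewrite /to_g (proj2 liftPhi) // /total_bracket /= /mixed.
case: b nil => [|y b] _; first by rewrite cats0 fst_hinl.
by rewrite /vals !map_cat /= (multisym0 lsym).
Qed.

(** All of [A] must enter the bracket, as [Theta] vanishes on any letter of [g] left over. *)
Lemma to_g_TPhi A b : to_g (T (Phi (sprod (mixed A b)))) =
  ush (@hdeg K h) b (fun b1 b2 => Theta (R (vals A) (vals b1) :: vals b2)).
Proof.
have Theta0 v : Theta (0 :: v) = 0 by exact: (multisym0 Thetasym [::]).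
rewrite (coder_sprod charK liftPhi) (ush_linear _ _ _ to_gT_linear).
have termE p q : to_g (T (coder_term 1 (total_bracket l R) p q)) =
    if p is [::] then 0 else Theta ((total_bracket l R p).2 :: map snd (vals q)).
  case: p => [|y p]; first exact: (lin0 to_gT_linear).
  rewrite to_g_T // (_ : map snd _ =
    (hval (coder_letter 1 (total_bracket l R) (y :: p))).2 :: map snd (vals q)) //.
  by rewrite (hval_coder_letter liftPhi).
under ush_ext => p q do rewrite termE.
rewrite /mixed ush_left; last first.
  move=> A1 x A2 p q1 q2 eA; have : x \in map (hinl h) A by rewrite eA mem_cat inE eqxx orbT.
  case/mapP=> y _ ->; case: p => // z p.
  by rewrite /vals map_cat map_cat /= -cat_cons (multisym0 Thetasym).
rewrite ush_map; apply: ush_ext => b1 b2.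
rewrite -[map _ A ++ map _ b1]/(mixed A b1) total_bracket_mixed snd_hinr.
by case: A b1 => [|x A] [|y b1] //; rewrite R00 Theta0.
Qed.

Hypothesis expE : exp_comm Phi T E.
Hypothesis RB : forall w : word h, w <> [::] -> proj_H E w = 0.

Lemma Rota_Baxter_identity (b : word h) : b <> [::] ->
  partsum (@hdeg K h) b (fun B => l (vals (map RB_letter B))) =
  ush (@hdeg K h) b (fun c r => partsum (@hdeg K h) c (fun B =>
    ush (@hdeg K h) r (fun r1 r2 =>
      Theta (R (vals (map RB_letter B)) (vals r1) :: vals r2)))).
Proof.
move=> b0; have bpos : (0 < size b)%N by case: (b) b0.
have [N expN] := expE (sprod (map hin b)).
(* Large enough for the commutator series to be stationary at this word and for both truncations of
   e^T to be complete on it. *)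
pose m := (N + size b).+1.
have := RB b0; rewrite /proj_H -(expN m.+1); last by rewrite /m; lia.
rewrite -/(to_g _) (lin_sum to_g_linear).
under eq_bigr => k _ do rewrite (linZ to_g_linear) -/(ad_iter k).
rewrite to_g_exp !exp_sum_mixed; try by rewrite /m; lia.
have lPhi := coder_linear liftPhi.
have lg1 : linear (fun X => to_g (Phi X)) by move=> a Y Z; rewrite lPhi to_g_linear.
have lg2 : linear (fun X => to_g (T (Phi X))) by move=> a Y Z; rewrite lPhi (to_gT_linear a).
rewrite (ush_linear _ _ _ lg1) (ush_linear _ _ _ lg2) => /eqP; rewrite subr_eq0 => /eqP e.
transitivity (ush (@hdeg K h) b (fun c r => to_g (Phi (partsum (@hdeg K h) c
    (fun B => sprod (mixed (map RB_letter B) r)))))).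
  (* By [to_g_Phi] a remaining letter of [h] makes the term vanish, so all of [b] is partitioned. *)
  rewrite ush_only_left.
    rewrite /partsum (lc_linear _ _ lg1); apply: eq_partsum => B _ _ B0.
    rewrite to_g_Phi //.
    by case: B B0 => // /(_ bpos).
  move=> c y r; rewrite /partsum (lc_linear _ _ lg1).
  transitivity (lc (parts_rec K (@hdeg K h) (size c) c) (fun=> 0 : g)); last exact: lc0.
  by apply: lc_ext => B; rewrite to_g_Phi //; case: B.
rewrite e; apply: ush_ext => c r; rewrite /partsum (lc_linear _ _ lg2).
by apply: lc_ext => B; rewrite to_g_TPhi.
Qed.
End RotaBaxterIdentity.

(** * Shuffle sums with a nonempty factor *)

Lemma shuffles_ush_pos (K : fieldType) (n : nat) (V : gvect K) (x : 'I_n -> helt V)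
    (W : lmodType K) (F : word V -> word V -> W) :
  \sum_(1 <= i < n.+1) \sum_(s : 'S_n | shuffle [:: i; (n - i)%N] s)
     koszul x s *: F (take i (pword x s)) (drop i (pword x s)) =
  ush (@hdeg K V) (codom x) (fun a b => if a is [::] then 0 else F a b).
Proof.
rewrite -shuffles_ush [RHS]big_ltn // [X in _ = X + _]big1 ?add0r => [|s _]; last first.
  by rewrite take0 scaler0.
apply: eq_big_nat => i /andP[i1 ilen]; apply: eq_bigr => s _.
have : size (take i (pword x s)) = i by apply: size_takel; rewrite size_map size_enum_ord.
by case: (take i _) => // i0; rewrite -i0 in i1.
Qed.

(** A splitting counts only for [j = size a] and [i = size b]; a nonempty [b] keeps this [j] below
    [n]. *)
Lemma shuffles3_ush (K : fieldType) (n : nat) (V : gvect K) (x : 'I_n -> helt V)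
    (W : lmodType K) (F : word V -> word V -> word V -> W) :
  \sum_(0 <= j < n) \sum_(1 <= i < n.+1 | (i + j <= n)%N)
    \sum_(s : 'S_n | shuffle [:: j; i; (n - j - i)%N] s)
     koszul x s *: F (take j (pword x s)) (take i (drop j (pword x s)))
       (drop (j + i) (pword x s)) =
  ush (@hdeg K V) (codom x) (fun a r => ush (@hdeg K V) r (fun b c =>
    if b is [::] then 0 else F a b c)).
Proof.
under eq_bigr => j _.
  under eq_bigr => i ij do rewrite shuffle3_ush 1?addnC //.
  rewrite -ush_sum.
  under ush_ext => a r do rewrite -ush_sum.
  over.
rewrite -ush_sum; apply: eq_ush => a r _ sar; rewrite -ush_sum; apply: eq_ush => b c _ sbc.
have sz : (size a + size b + size c)%N = n by move: sar; rewrite -sbc size_codom card_ord; lia.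
case: b sbc sz => [|y b] sbc sz.
  rewrite big1_seq // => j _; rewrite big_nat_cond big1 // => i /andP[/andP[i1 _] _].
  by case: i i1 => // i _; rewrite andbF.
have an : (size a < n)%N by move: sz => /=; lia.
rewrite big_mkord (bigD1 (Ordinal an)) //= [X in _ + X]big1 ?addr0 => [|j ja]; last first.
  rewrite big1 // => i _; case: eqP => //= e; case/eqP: ja; exact/val_inj.
rewrite eqxx big_mkcond (bigD1_seq (size b).+1) ?iota_uniq ?mem_index_iota //=; last first.
  by move: sz => /=; lia.
rewrite eqxx ifT; last by move: sz => /=; lia.
rewrite big1 ?addr0 // => i ib; rewrite [_ == i]eq_sym (negPf ib).
by case: ifP.
Qed.

(** * Extension from homogeneous words to arbitrary vectors *)

Section HomogeneousExpansion.
Variables (K : fieldType) (V : gvect K) (W : lmodType K).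
Implicit Types (f : word V -> W) (v : V) (vs : seq V).

Definition letter_linear f := forall (A B : word V) k x y z,
  hdeg z = hdeg x -> hdeg z = hdeg y -> hval z = k *: hval x + hval y ->
  f (A ++ z :: B) = k *: f (A ++ x :: B) + f (A ++ y :: B).

Definition letter_symmetric f := forall (A B : word V) x y,
  f (A ++ x :: y :: B) = sgn K (hdeg x * hdeg y) *: f (A ++ y :: x :: B).

Definition hsupp v : seq int := s2val (cid2 (hcomp_sum v)).

Lemma hsupp_uniq v : uniq (hsupp v).
Proof. exact: (s2valP (cid2 (hcomp_sum v))). Qed.

Lemma hsupp_sum v : v = \sum_(d <- hsupp v) hcomp d v.
Proof. exact: (s2valP' (cid2 (hcomp_sum v))). Qed.

Lemma hsupp_out v d : d \notin hsupp v -> hcomp d v = 0.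
Proof.
move=> dv; rewrite [v in hcomp d v]hsupp_sum (lin_sum (@hcomp_linear K V d)).
rewrite big_seq big1 // => e ev; rewrite hcomp_proj; case: eqP => // de.
by rewrite de ev in dv.
Qed.

(** The chosen supports of different vectors differ; sums over them are compared on a common index
    set. *)
Lemma hsupp_widen v (r : seq int) (G : int -> W) : uniq r -> {subset hsupp v <= r} ->
  (forall d, hcomp d v = 0 -> G d = 0) ->
  \sum_(d <- hsupp v) G d = \sum_(d <- r) G d.
Proof.
move=> ur sub G0; rewrite [RHS](bigID (mem (hsupp v))) /= [X in _ + X]big1 ?addr0; last first.
  by move=> d /hsupp_out /G0.
rewrite -[RHS]big_filter; apply: perm_big; apply: uniq_perm; rewrite ?filter_uniq ?hsupp_uniq //.
by move=> d; rewrite mem_filter; case dv: (d \in hsupp v); rewrite //= sub.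
Qed.

(** The multilinear extension of [f]. A post-Lie product takes lists of arbitrary vectors, whereas
    the signs in a sum over partitions require homogeneous letters. *)
Fixpoint hext f vs : W :=
  if vs is v :: vs' then \sum_(d <- hsupp v) hext (fun w => f (hproj d v :: w)) vs'
  else f [::].

Lemma hext_ext f1 f2 vs : f1 =1 f2 -> hext f1 vs = hext f2 vs.
Proof.
elim: vs f1 f2 => [|v vs IH] f1 f2 e /=; first exact: e.
by apply: eq_bigr => d _; apply: IH => w.
Qed.

Lemma hext_lin k f1 f2 vs :
  hext (fun w => k *: f1 w + f2 w) vs = k *: hext f1 vs + hext f2 vs.
Proof.
elim: vs f1 f2 => [|v vs IH] f1 f2 //=.
by rewrite scaler_sumr -big_split; apply: eq_bigr => d _; rewrite IH.
Qed.

Lemma hext0 vs : hext (fun=> 0) vs = 0.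
Proof. by elim: vs => [|v vs IH] //=; rewrite big1. Qed.

Lemma hextZ k f vs : hext (fun w => k *: f w) vs = k *: hext f vs.
Proof.
have := hext_lin k f (fun=> 0) vs; rewrite hext0 addr0 => <-.
by apply: hext_ext => w; rewrite addr0.
Qed.

Lemma letter_linear0 f A B (z : helt V) : letter_linear f -> hval z = 0 -> f (A ++ z :: B) = 0.
Proof.
move=> lf z0; rewrite (lf A B (-1) z z z) ?z0 ?scaler0 ?addr0 //.
by rewrite scaleN1r addNr.
Qed.

Lemma letter_linear_cons f x : letter_linear f -> letter_linear (fun w => f (x :: w)).
Proof. by move=> lf A B k a b c *; rewrite -!cat_cons; apply: lf. Qed.

Lemma letter_symmetric_cons f x : letter_symmetric f -> letter_symmetric (fun w => f (x :: w)).
Proof. by move=> sf A B a b; rewrite -!cat_cons; apply: sf. Qed.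

Lemma hext_zero_letter f d v vs : letter_linear f -> hcomp d v = 0 ->
  hext (fun w => f (hproj d v :: w)) vs = 0.
Proof.
move=> lf v0; rewrite -[RHS](hext0 vs); apply: hext_ext => w.
exact: (letter_linear0 (z := hproj d v) [::] w lf v0).
Qed.

Lemma hext_multilinear f s1 s2 k u v : letter_linear f ->
  hext f (s1 ++ (k *: u + v) :: s2) = k *: hext f (s1 ++ u :: s2) + hext f (s1 ++ v :: s2).
Proof.
elim: s1 f => [|t s1 IH] f lf /=; last first.
  rewrite scaler_sumr -big_split; apply: eq_bigr => d _; apply: IH.
  exact: letter_linear_cons.
pose r := undup (hsupp (k *: u + v) ++ hsupp u ++ hsupp v).
rewrite !(@hsupp_widen _ r) ?undup_uniq //; try by move=> d; exact: hext_zero_letter.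
- rewrite scaler_sumr -big_split; apply: eq_bigr => d _ /=; rewrite -hext_lin.
  apply: hext_ext => w; apply: (lf [::]) => //.
  by rewrite !hval_hproj hcomp_linear.
- by move=> d dd; rewrite mem_undup !mem_cat dd ?orbT.
- by move=> d dd; rewrite mem_undup !mem_cat dd ?orbT.
- by move=> d dd; rewrite mem_undup !mem_cat dd ?orbT.
Qed.

Lemma hext_hval f (x : helt V) vs : letter_linear f ->
  hext f (hval x :: vs) = hext (fun w => f (x :: w)) vs.
Proof.
(* The support of a zero vector need not contain the degree chosen for the letter, so that degree is
   added. *)
move=> lf /=; rewrite (@hsupp_widen _ (undup (hdeg x :: hsupp (hval x)))) ?undup_uniq //.
- rewrite (bigD1_seq (hdeg x)) ?undup_uniq ?mem_undup ?mem_head //= hprojK big1 ?addr0 //.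
  move=> d dx; apply: hext_zero_letter => //.
  have /eqP <- := homog_hval x; by rewrite hcomp_proj (negPf dx).
- by move=> d dd; rewrite mem_undup inE dd orbT.
- by move=> d; exact: hext_zero_letter.
Qed.

Lemma hext_vals f (w : word V) : letter_linear f -> hext f (vals w) = f w.
Proof.
elim: w f => [|x w IH] f lf //; rewrite hext_hval // IH //.
exact: letter_linear_cons.
Qed.

Lemma hext_multisym f : letter_linear f -> letter_symmetric f -> multisym (hext f).
Proof.
move=> lf sf; split=> [s1 s2 k u v|s1 s2 x y]; first exact: hext_multilinear.
elim: s1 f lf sf => [|t s1 IH] f lf sf.
  rewrite !cat0s !hext_hval //; try exact: letter_linear_cons.
  by rewrite -hextZ; apply: hext_ext => w; exact: (sf [::]).
rewrite /= scaler_sumr; apply: eq_bigr => d _; apply: IH.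
  exact: letter_linear_cons.
exact: letter_symmetric_cons.
Qed.
End HomogeneousExpansion.

Section LetterwiseBlocks.
Variables (K : fieldType) (V : gvect K) (W : lmodType K).
Local Notation deg := (@hdeg K V).
Implicit Types (F : seq (word V) -> W).

Definition block_linear F := forall (p q : seq (word V)),
  letter_linear (fun b => F (p ++ b :: q)).

Definition block_symmetric F := forall (p q : seq (word V)),
  letter_symmetric (fun b => F (p ++ b :: q)).

Lemma ushk_letter_linear k F : block_linear F -> letter_linear (fun w => ushk deg k w F).
Proof.
elim: k F => [|k IH] F lF A B c x y z zx zy e.
  by rewrite !ushk0; case: A => [|a A] /=; rewrite scaler0 addr0.
rewrite !ushkS; apply: ush_lin_letter => // [p1 p2 q|p q1 q2].
  by rewrite -lcZ -lcD; apply: lc_ext => C; apply: (lF [::]).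
by apply: (IH (fun C => F (p :: C))) => // r s; exact: (lF (p :: r)).
Qed.

Lemma ushk_letter_symmetric k F :
  block_symmetric F -> letter_symmetric (fun w => ushk deg k w F).
Proof.
elim: k F => [|k IH] F lF A B x y.
  by rewrite !ushk0; case: A => [|a A] /=; rewrite scaler0.
rewrite !ushkS; apply: ush_swap_letters => [p1 p2 q|p q1 q2].
  by rewrite -lcZ; apply: lc_ext => C; apply: (lF [::]).
by apply: (IH (fun C => F (p :: C))) => r s; exact: (lF (p :: r)).
Qed.

Lemma nonempty_blocks_linear F : block_linear F -> block_linear (nonempty_blocks F).
Proof.
move=> lF p q A B c x y z zx zy e; rewrite /nonempty_blocks !all_cat /= !size_cat /=.
by case: ifP => _; [exact: lF|rewrite scaler0 addr0].
Qed.

Lemma nonempty_blocks_symmetric F : block_symmetric F -> block_symmetric (nonempty_blocks F).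
Proof.
move=> lF p q A B x y; rewrite /nonempty_blocks !all_cat /= !size_cat /=.
by case: ifP => _; [exact: lF|rewrite scaler0].
Qed.

Hypothesis charK : [pchar K] =i pred0.
Variable F : seq (word V) -> W.
Hypothesis symF : blocks_sym deg F.

Lemma partsum_letter_linear : block_linear F -> letter_linear (fun w => partsum deg w F).
Proof.
move=> lF A B c x y z zx zy e.
have N w : (size w < (size A + (size B).+1).+1)%N -> _ := @partsum_ushk K _ deg _ _ w F charK symF.
rewrite !N ?size_cat //= scaler_sumr -big_split; apply: eq_bigr => k _ /=.
rewrite (ushk_letter_linear k (nonempty_blocks_linear lF) A B zx zy e).
by rewrite scalerDr !scalerA mulrC.
Qed.

(** Exchanging letters can change the order in which [partsum] lists the blocks; the sum over
    ordered partitions treats all blocks alike, and each of its terms is symmetric. *)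
Lemma partsum_letter_symmetric :
  block_symmetric F -> letter_symmetric (fun w => partsum deg w F).
Proof.
move=> lF A B x y.
have N w : (size w < (size A + (size B).+2).+1)%N -> _ := @partsum_ushk K _ deg _ _ w F charK symF.
rewrite !N ?size_cat //= scaler_sumr; apply: eq_bigr => k _ /=.
by rewrite (ushk_letter_symmetric k (nonempty_blocks_symmetric lF)) !scalerA mulrC.
Qed.
End LetterwiseBlocks.

(** * The post-Lie structure *)

Section PostLie.
Variables (K : fieldType) (g h : gvect K) (charK : [pchar K] =i pred0).
Variables (l : seq g -> g) (mu : seq h -> h) (R : seq g -> seq h -> h) (Theta : seq h -> g).
Hypotheses (action : L_infty_action l mu R) (thetaRB : homotopy_Rota_Baxter l R Theta).
Local Notation dh := (@hdeg K h).
Local Notation dg := (@hdeg K g).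
Local Notation letter := (RB_letter Theta).

Let lsym : multisym l. Proof. by case: action => -[]. Qed.
Let Rop : open_closed l R. Proof. by case: action. Qed.
Let R00 : R [::] [::] = 0. Proof. by case: Rop. Qed.
Let Rsyml us : multisym (fun xs => R xs us). Proof. by case: Rop => _ _ []. Qed.
Let Rsymr xs : multisym (R xs). Proof. by case: Rop => _ _ []. Qed.
Let Rnil xs : R xs [::] = 0.
Proof. by case: xs => // x xs; case: action => _ _ _ _; apply. Qed.
Let Thetasym : multisym Theta. Proof. by case: thetaRB. Qed.

Lemma R_homog (v : word g) (w : word h) : homog (wdeg v + wdeg w + 1) (R (vals v) (vals w)).
Proof.
case: v w => [|x v] [|y w]; first by rewrite R00 homog0.
all: by case: Rop => _ _ _ + _; apply.
Qed.

Lemma hval_RB_letter (b : word h) : b <> [::] -> hval (letter b) = Theta (vals b).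
Proof.
move=> b0; apply: homogP; rewrite -[wdeg b]addr0.
by case: thetaRB => _ + _; apply.
Qed.

Definition block_value (vs : seq h) (B : seq (word h)) : h := R (vals (map letter B)) vs.

Definition post_word (w : word h) (vs : seq h) : h := partsum dh w (block_value vs).

Definition post_product (us vs : seq h) : h := hext (fun w => post_word w vs) us.

Lemma block_value_sym vs : blocks_sym dh (block_value vs).
Proof.
move=> p q a b; rewrite /block_value /vals !map_cat /=.
exact: (multisym_swap (Rsyml vs)).
Qed.

Lemma block_value_linear vs : block_linear (block_value vs).
Proof.
move=> p q A B k x y z zx zy e; rewrite /block_value /vals !map_cat /= !hval_hproj.
rewrite -(multisym_lin (Rsyml vs)); congr (R (_ ++ _ :: _) vs).
rewrite !wdeg_cat !wdeg_cons -zx -zy -hcomp_linear.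
by rewrite /vals !map_cat /= e (multisym_lin Thetasym).
Qed.

Lemma block_value_symmetric vs : block_symmetric (block_value vs).
Proof.
move=> p q A B x y; rewrite /block_value /vals !map_cat /= !hval_hproj.
rewrite -(linZ (multisym_linear (Rsyml vs) _ _)); congr (R (_ ++ _ :: _) vs).
rewrite !wdeg_cat !wdeg_cons [hdeg x + _]addrCA.
rewrite -(linZ (@hcomp_linear K g _)) /vals !map_cat /=.
by rewrite (multisym_swap Thetasym).
Qed.

Lemma post_word_linear vs : letter_linear (fun w => post_word w vs).
Proof. exact: (partsum_letter_linear charK (@block_value_sym vs) (@block_value_linear vs)). Qed.

Lemma post_word_symmetric vs : letter_symmetric (fun w => post_word w vs).
Proof.
exact: (partsum_letter_symmetric charK (@block_value_sym vs) (@block_value_symmetric vs)).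
Qed.

Lemma post_product_vals w vs : post_product (vals w) vs = post_word w vs.
Proof. exact: (hext_vals w (@post_word_linear vs)). Qed.

Lemma post_word_nil vs : post_word [::] vs = R [::] vs.
Proof. exact: partsum_nil. Qed.

Lemma post_word_nilr w : post_word w [::] = 0.
Proof.
rewrite -[RHS](lc0 _ (parts_rec K dh (size w) w)); apply: lc_ext => B; exact: Rnil.
Qed.

Lemma post_word_multisym w : multisym (post_word w).
Proof.
split=> [s1 s2 k x y|s1 s2 x y].
  rewrite /post_word /partsum -lcZ -lcD; apply: lc_ext => B.
  exact: (multisym_lin (Rsymr _)).
rewrite /post_word /partsum -lcZ; apply: lc_ext => B.
exact: (multisym_swap (Rsymr _)).
Qed.

Lemma post_product_multisymr us : multisym (post_product us).
Proof.
split=> [s1 s2 k x y|s1 s2 x y].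
  rewrite /post_product -hext_lin; apply: hext_ext => w.
  exact: (multisym_lin (post_word_multisym w)).
rewrite /post_product -hextZ; apply: hext_ext => w.
exact: (multisym_swap (post_word_multisym w)).
Qed.

Lemma post_product_multisyml vs : multisym (fun us => post_product us vs).
Proof. exact: hext_multisym (@post_word_linear vs) (@post_word_symmetric vs). Qed.

Lemma wdeg_letters (B : seq (word h)) : wdeg (map letter B) = degs (degs dh) B.
Proof. by rewrite wdegE degs_map. Qed.

Lemma post_word_homog v w : homog (wdeg v + wdeg w + 1) (post_word v (vals w)).
Proof.
(* [homog_lc] asks for homogeneity at every list of blocks, so the terms are replaced by projections
   that agree with them on the partitions of [v]. *)
rewrite /post_word (eq_partsum (G := fun B => hcomp (wdeg v + wdeg w + 1) (block_value (vals w) B))).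
  by apply: homog_lc => B; exact: hproj_subproof.
move=> B dB _ _; have := R_homog (map letter B) w.
by rewrite wdeg_letters dB => /eqP ->.
Qed.

Lemma post_product_formula p (u : 'I_p -> helt h) vs : (0 < p)%N ->
  post_product (vals (codom u)) vs = post_Lie_formula R Theta u vs.
Proof.
move=> p0; rewrite post_product_vals.
have sz : size (codom u) = p by rewrite size_codom card_ord.
rewrite /post_word (partsum_ushk (N := p.+1) charK (@block_value_sym vs)) ?sz //.
rewrite /post_Lie_formula big_ord_recl.
(* A nonempty word has no partition into zero blocks, in accordance with the formula starting at k =
   1. *)
rewrite ushk0 -[X in _ *: X](_ : 0 = _) ?scaler0 ?add0r; last first.
  by move: sz p0; case: (codom u) => //= <-.
rewrite big_add1 /= big_mkord; apply: eq_bigr => k _.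
pose F (B : seq (word h)) := R (map Theta (map (@vals K h) B)) vs.
under [RHS]eq_bigr => c /andP[/eqP sc _].
  under eq_bigr => s _.
    rewrite mulrC -scalerA /vals -map_reshape -/(F (reshape (map val c) (pword u s))).
    over.
  rewrite -scaler_sumr shuffle_ushk // size_map size_tuple.
  over.
rewrite -scaler_sumr; congr (_ *: _).
rewrite /ushk -lc_sum; apply: eq_ushk => B sB _ fB.
rewrite sz in fB; rewrite /nonempty_blocks.
have allE : all (fun b : word h => 0 < size b)%N B = all (fun i => 0 < i)%N (shape B).
  by rewrite all_map.
rewrite allE; case: ifP => [pos|npos]; last first.
  rewrite big1 // => c /andP[_ cpos]; case: eqP => // e; move: npos.
  by rewrite e all_map (eq_all (a2 := fun i : 'I_p.+1 => 0 < i)%N) // cpos.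
have le_p i : i \in shape B -> (i <= p)%N.
  by move=> /mapP[b bB ->]; rewrite -fB -size_flatten; elim: (B) bB => //= b' B' IH;
    rewrite inE size_cat => /predU1P[->|/IH]; lia.
(* The only composition contributing at [B] is its shape, whose entries are at most [p], so [inord]
   loses nothing. *)
have sc : size (map (inord : nat -> 'I_p.+1) (shape B)) == k.+1 by rewrite !size_map sB.
have ec : map val (Tuple sc) = shape B.
  rewrite /= -map_comp -[RHS]map_id; apply/eq_in_map => i /le_p ip /=.
  by rewrite inordK.
rewrite (bigD1 (Tuple sc)) /=; last first.
  by rewrite ec fB eqxx /= -(all_map val (fun i => 0 < i)%N) ec.
rewrite ec eqxx big1 ?addr0 => [|c /andP[_ ne]].
  rewrite /block_value /F; congr (R _ vs); rewrite /vals -!map_comp; apply/eq_in_map => b bB /=.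
  rewrite hval_RB_letter // => b0.
  by move/allP: pos => /(_ (size b)); rewrite map_f // b0 => /(_ isT).
case: eqP => // e; case/eqP: ne; apply/val_inj; apply: (inj_map val_inj).
by rewrite ec e.
Qed.

Lemma open_closed_ush (v : word g) (w : word h) : (0 < size v + size w)%N ->
  ush dg v (fun a b => if a is [::] then 0 else R (l (vals a) :: vals b) (vals w)) +
  ush dg v (fun a b => ush dh w (fun c d =>
    sgn K (wdeg a) *: R (vals a) (R (vals b) (vals c) :: vals d))) = 0.
Proof.
move=> pos; case: Rop => _ _ _ _ /(_ _ _ (tnth (in_tuple v)) (tnth (in_tuple w)) pos).
have ev : codom (tnth (in_tuple v)) = v by rewrite codomE map_tnth_enum.
have ew : codom (tnth (in_tuple w)) = w by rewrite codomE map_tnth_enum.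
rewrite ew => e; rewrite -[RHS]e; congr (_ + _).
  rewrite -[X in ush _ X]ev -shuffles_ush_pos; apply: eq_bigr => i _; apply: eq_bigr => s _.
  by rewrite /vals map_take map_drop.
rewrite -[X in ush dg X]ev -shuffles_ush; apply: eq_bigr => i _.
rewrite exchange_big; apply: eq_bigr => s _ /=.
rewrite -[X in ush dh X]ew -shuffles_ush scaler_sumr; apply: eq_bigr => j _.
rewrite scaler_sumr; apply: eq_bigr => t _.
rewrite !scalerA /vals !map_take !map_drop; congr (_ *: _).
Qed.

Lemma partsum_ush_exchange (W : lmodType K) (c r : word h)
    (G : seq (word h) -> word h -> word h -> W) :
  partsum dh c (fun B => ush dh r (G B)) =
  ush dh r (fun a b => partsum dh c (fun B => G B a b)).
Proof. exact: (lc_exchange _ _ (fun B p => G B p.1 p.2)). Qed.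

Lemma partsum_exchange (W : lmodType K) (c r : word h)
    (G : seq (word h) -> seq (word h) -> W) :
  partsum dh c (fun A => partsum dh r (G A)) =
  partsum dh r (fun B => partsum dh c (fun A => G A B)).
Proof. exact: lc_exchange. Qed.

Lemma Theta0 vs : Theta (0 :: vs) = 0.
Proof. exact: (multisym0 Thetasym [::]). Qed.

(** Summing over the partitions of [c] inside [Theta] produces M(c, r1). The terms with empty [r1]
    vanish because an action has R_{p,0} = 0. *)
Lemma Rota_Baxter_post (a : word h) : a <> [::] ->
  partsum dh a (fun B => l (vals (map letter B))) =
  ush dh a (fun c r => ush dh r (fun r1 r2 =>
    if r1 is [::] then 0 else
      hval (letter (hproj (wdeg c + wdeg r1 + 1) (post_word c (vals r1)) :: r2)))).
Proof.
move=> a0; case: thetaRB => _ _ [Phi [T [E [liftPhi liftT expE RB]]]].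
rewrite (Rota_Baxter_identity charK lsym Rsyml Rsymr R00 Thetasym liftPhi liftT expE RB a0).
apply: ush_ext => c r; rewrite partsum_ush_exchange; apply: ush_ext => r1 r2.
have lTheta : linear (fun u => Theta (u :: vals r2)) := multisym_linear Thetasym [::] (vals r2).
transitivity (Theta (post_word c (vals r1) :: vals r2)).
  exact: esym (lc_linear _ _ lTheta).
case: r1 => [|y r1]; first by rewrite post_word_nilr Theta0.
rewrite hval_RB_letter //= hval_hproj; congr (Theta (_ :: _)).
by have /eqP -> := post_word_homog c (y :: r1).
Qed.

Lemma post_word_cons z w vs : post_word (z :: w) vs =
  ush dh w (fun a b => partsum dh b (fun B => R (hval (letter (z :: a)) :: vals (map letter B)) vs)).
Proof. exact: partsum_cons. Qed.

Lemma R_lin_first us vs : linear (fun x => R (x :: us) vs).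
Proof. exact: (multisym_linear (Rsyml vs) [::] us). Qed.

Lemma R_lin_second xs us : linear (fun x => R xs (x :: us)).
Proof. exact: (multisym_linear (Rsymr xs) [::] us). Qed.

Lemma post_Lie_ush (x y : word h) : (0 < size y)%N ->
  ush dh x (fun a r => ush dh r (fun b c => if b is [::] then 0 else
    post_product (post_product (vals a) (vals b) :: vals c) (vals y))) +
  ush dh x (fun a b => sgn K (wdeg a) *: ush dh y (fun c d => if c is [::] then 0 else
    post_product (vals a) (post_product (vals b) (vals c) :: vals d))) = 0.
Proof.
move=> y0.
transitivity (partsum dh x (fun B => 0 : h)); last exact: lc0.
(* The open-closed identity is applied to the [Theta]-images of the blocks of every set partition of
   [x], and the results are summed. *)
transitivity (partsum dh x (fun B =>
  ush dg (map letter B) (fun a b => if a is [::] then 0 else R (l (vals a) :: vals b) (vals y)) +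
  ush dg (map letter B) (fun a b => ush dh y (fun c d =>
    sgn K (wdeg a) *: R (vals a) (R (vals b) (vals c) :: vals d))))); last first.
  by apply: partsum_ext => B; apply: open_closed_ush; lia.
rewrite /partsum lcD -!/(partsum _ _ _); congr (_ + _).
  under [RHS]partsum_ext => B do rewrite ush_map.
  rewrite partsum_ush.
  (* In M(M(c, r1) t2, y) the block of the first letter M(c, r1) takes [r2] out of [t2];
     coassociativity gathers [c], [r1] and [r2] into one part [a] of [x]. *)
  transitivity (ush dh x (fun a b => ush dh a (fun c r => ush dh r (fun r1 r2 =>
     partsum dh b (fun B => if r1 is [::] then 0 else
       R (hval (letter (hproj (wdeg c + wdeg r1 + 1) (post_word c (vals r1)) :: r2)) ::
          vals (map letter B)) (vals y)))))).
    rewrite ushA; apply: ush_ext => c t; rewrite ushA; apply: ush_ext => -[|u r1] t2.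
      rewrite -[LHS](ush0 dh _ t2); apply: ush_ext => r2 b; apply/esym; exact: lc0.
    rewrite post_product_vals -(homogP (post_word_homog c (u :: r1))).
    by rewrite -[_ :: vals t2]/(vals (_ :: t2)) post_product_vals post_word_cons homogP ?post_word_homog.
  apply: ush_ext => -[|u a] b.
    by rewrite !ush_nil partsum_nil.
  set RHS0 := RHS.
  (* Linearity in the first argument moves the sum over the splittings of this part inside [R],
     where it is the right side of the Rota-Baxter equation. *)
  transitivity (partsum dh b (fun B => R (ush dh (u :: a) (fun c r => ush dh r (fun r1 r2 =>
      if r1 is [::] then 0 else
        hval (letter (hproj (wdeg c + wdeg r1 + 1) (post_word c (vals r1)) :: r2)))) ::
      vals (map letter B)) (vals y))).
    transitivity (partsum dh b (fun B => ush dh (u :: a) (fun c r => ush dh r (fun r1 r2 =>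
      if r1 is [::] then 0 else
       R (hval (letter (hproj (wdeg c + wdeg r1 + 1) (post_word c (vals r1)) :: r2)) ::
          vals (map letter B)) (vals y))))).
      rewrite partsum_ush_exchange; apply: ush_ext => c r.
      by rewrite partsum_ush_exchange; apply: ush_ext => -[|v r1] r2.
    apply: partsum_ext => B; apply: etrans (esym (ush_linear _ _ _ (R_lin_first _ _))).
    apply: ush_ext => c r; apply: etrans (esym (ush_linear _ _ _ (R_lin_first _ _))).
    apply: ush_ext => -[|v r1] r2 //; exact: esym (lin0 (R_lin_first _ _)).
  rewrite -Rota_Baxter_post //.
  transitivity (partsum dh b (fun B => partsum dh (u :: a) (fun A =>
      R (l (vals (map letter A)) :: vals (map letter B)) (vals y)))).
    by apply: partsum_ext => B; exact: (lc_linear _ _ (R_lin_first _ _)).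
  (* A partition of the nonempty word [u :: a] has a block, so the case of an empty argument of [l]
     does not arise. *)
  rewrite {}/RHS0 [LHS]partsum_exchange; apply: eq_partsum => A _ _ /(_ isT).
  by case: A.
under [RHS]partsum_ext => B do rewrite ush_map.
rewrite partsum_ush; apply: ush_ext => a b.
transitivity (partsum dh a (fun A => sgn K (wdeg a) *: ush dh y (fun c d =>
    R (vals (map letter A)) (post_word b (vals c) :: vals d)))).
  rewrite /partsum lcZ -/(partsum _ _ _); congr (_ *: _).
  (* For empty [c] the inner product is zero by [post_word_nilr], in agreement with the excluded
     case. *)
  rewrite partsum_ush_exchange; apply: ush_ext => -[|v c] d; last by rewrite !post_product_vals.
  rewrite post_word_nilr -[LHS](lc0 _ (parts_rec K dh (size a) a)); apply: lc_ext => A.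
  exact: esym (multisym0 (Rsymr _) [::] _).
apply: eq_partsum => A dA _ _; rewrite partsum_ush_exchange -ushZ; apply: ush_ext => c d.
rewrite /partsum lcZ wdeg_letters dA; congr (_ *: _).
exact: (lc_linear _ _ (R_lin_second _ _)).
Qed.
End PostLie.

Theorem theorem5p10 (K : fieldType) (charK : [pchar K] =i pred0)
    (g h : gvect K) (l : seq g -> g) (mu : seq h -> h)
    (R : seq g -> seq h -> h) (Theta : seq h -> g)
    (action : L_infty_action l mu R)
    (thetaRB : homotopy_Rota_Baxter l R Theta) :
  exists M : seq h -> seq h -> h,
    [/\ forall vs : seq h, vs <> [::] -> M [::] vs = mu vs,
        forall (p : nat) (u : 'I_p -> helt h) (vs : seq h),
          (0 < p)%N -> vs <> [::] ->
          M (vals (codom u)) vs = post_Lie_formula R Theta u vs &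
        post_Lie_infty M].
Proof.
exists (post_product R Theta); split.
- move=> vs vs0; rewrite -[[::]]/(vals ([::] : word h)).
  rewrite (post_product_vals charK action thetaRB) post_word_nil.
  by case: action => _ _ _ + _; apply.
- by move=> p u vs p0 _; exact: (post_product_formula charK action thetaRB).
split.
- split=> [vs _|us]; first exact: (post_product_multisyml charK action thetaRB).
  exact: (post_product_multisymr Theta action).
- move=> v w _; rewrite (post_product_vals charK action thetaRB).
  exact: (post_word_homog Theta action).
move=> n m x y m0.
have y0 : (0 < size (codom y))%N by rewrite size_codom card_ord.
rewrite -[RHS](post_Lie_ush charK action thetaRB (codom x) y0).
congr (_ + _).
  rewrite -shuffles3_ush; apply: eq_bigr => j _; apply: eq_bigr => i _; apply: eq_bigr => s _.
  by rewrite /vals !map_take !map_drop.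
(* The index [j] counts the letters of the second factor of the unshuffle, so the sum is reversed to
   count those of the first. *)
rewrite big_nat_rev /= add0n -shuffles_ush; apply: eq_big_nat => j /andP[_ jn].
rewrite subSS (_ : (n - (n - j))%N = j); last by rewrite subKn.
apply: eq_bigr => s _; rewrite -shuffles_ush_pos !scaler_sumr.
refine (eq_bigr _ _) => i _.
rewrite !scaler_sumr; refine (eq_bigr _ _) => t _.
rewrite !scalerA /vals !map_take !map_drop; congr (_ *: _).
ring.
Qed.
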